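(* Let $r > 0$ and let $V : (-r, r) \to \mathbb{R}$ be bounded, measurable and symmetric, i.e. $V(-x) = V(x)$ for all $x \in (-r, r)$. Then the following assertions hold. (i) If $V$ is non-increasing and non-constant on $(0, r)$, then $\mu_2(V) < \lambda_1(V)$. (ii) If $V$ is non-decreasing and non-constant on $(0, r)$, then $\lambda_1(V) < \mu_2(V)$.
   Context: For a bounded open interval $\Omega = (a,b)$ and a bounded measurable function $V : \Omega \to \mathbb{R}$, denote by $\mu_1(V) < \mu_2(V) \leq \mu_3(V) \leq \dots$ the eigenvalues, counted with multiplicities, of the self-adjoint Neumann Schrödinger operator $u \mapsto -u'' + V u$ in $L^2(\Omega)$ with domain $\{u \in H^2(\Omega) : u'(a) = u'(b) = 0\}$, and by $\lambda_1(V) < \lambda_2(V) \leq \lambda_3(V) \leq \dots$ the eigenvalues, counted with multiplicities, of the self-adjoint Dirichlet Schrödinger operator $u \mapsto -u'' + V u$ in $L^2(\Omega)$ with domain $\{u \in H^2(\Omega) : u(a) = u(b) = 0\}$. In the claim, $\Omega = (-r, r)$. *)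

(* Defs.v *)
From HB Require Import structures.
From mathcomp Require Import all_boot all_order all_algebra.
From mathcomp Require Import all_classical all_reals all_analysis.

Set Implicit Arguments.
Unset Strict Implicit.
Unset Printing Implicit Defensive.

Import Order.TTheory GRing.Theory Num.Theory.
Import numFieldNormedType.Exports.

Local Open Scope classical_set_scope.
Local Open Scope ring_scope.

(* F is absolutely continuous on [a, b], with derivative f (almost everywhere)
   in L^1: F is an indefinite Lebesgue integral of f. *)
Definition ac_with_deriv (R : realType) (a b : R) (F f : R -> R) : Prop :=
  lebesgue_measure.-integrable `[a, b] (EFin \o f) /\
  {in `[a, b], forall x,
    F x = F a + \int[lebesgue_measure]_(t in `[a, x]) f t}.

Definition L2_on (R : realType) (a b : R) (f : R -> R) : Prop :=
  measurable_fun `]a, b[ f /\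
  lebesgue_measure.-integrable `]a, b[ (EFin \o (fun x => f x ^+ 2)).

(* u is the C^1 representative on [a, b] of an element of H^2(a, b), with first
   derivative u1 (the continuous representative, so that u1 a and u1 b are
   meaningful) and second derivative u2.  Since u and u1 are continuous on
   [a, b], they are automatically in L^2(a, b).  Values outside [a, b] are
   irrelevant. *)
Definition H2_with_derivs (R : realType) (a b : R) (u u1 u2 : R -> R) : Prop :=
  [/\ ac_with_deriv a b u u1, ac_with_deriv a b u1 u2 & L2_on a b u2].

(* Graphs of the operators u |-> - u'' + V u in L^2(a, b): u is in the domain
   and is mapped to f. *)
Definition neumann_schrodinger (R : realType) (a b : R) (V u f : R -> R)
    : Prop :=
  exists u1 u2 : R -> R,
    [/\ H2_with_derivs a b u u1 u2,
        u1 a = 0, u1 b = 0 &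
        ae_eq lebesgue_measure `]a, b[%classic f (fun x => - u2 x + V x * u x)].

Definition dirichlet_schrodinger (R : realType) (a b : R) (V u f : R -> R)
    : Prop :=
  exists u1 u2 : R -> R,
    [/\ H2_with_derivs a b u u1 u2,
        u a = 0, u b = 0 &
        ae_eq lebesgue_measure `]a, b[%classic f (fun x => - u2 x + V x * u x)].

Definition eigenspace_of (R : realType) (A : (R -> R) -> (R -> R) -> Prop)
    (t : R) : set (R -> R) :=
  [set u | A u (fun x => t * u x)].

(* E, seen as a linear subspace of L^2(a, b) (functions modulo equality almost
   everywhere), has a basis with n elements. *)
Definition has_dim (R : realType) (a b : R) (E : set (R -> R)) (n : nat)
    : Prop :=
  exists e : 'I_n -> R -> R,
    [/\ forall i, E (e i),
        forall c : 'I_n -> R,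
          ae_eq lebesgue_measure `]a, b[%classic
            (fun x => \sum_(i < n) c i * e i x) (fun=> 0) ->
          forall i, c i = 0 &
        forall u, E u -> exists c : 'I_n -> R,
          ae_eq lebesgue_measure `]a, b[%classic
            u (fun x => \sum_(i < n) c i * e i x)].

(* m 1 <= m 2 <= m 3 <= ... is the list of all eigenvalues of A, counted with
   multiplicities; m 0 is not used.  A real t that is not an eigenvalue has a
   zero-dimensional eigenspace and hence does not occur in the list. *)
Definition eigenvalue_seq (R : realType) (a b : R)
    (A : (R -> R) -> (R -> R) -> Prop) (m : nat -> R) : Prop :=
  nondecreasing_seq (fun k => m k.+1) /\
  forall t : R, exists n : nat,
    has_dim a b (eigenspace_of A t) n /\
    ([set k | (0 < k)%N /\ m k = t] #= `I_n)%card.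

Definition neumann_eigenvalues (R : realType) (a b : R) (V : R -> R)
    (mu : nat -> R) : Prop :=
  eigenvalue_seq a b (neumann_schrodinger a b V) mu.

Definition dirichlet_eigenvalues (R : realType) (a b : R) (V : R -> R)
    (lam : nat -> R) : Prop :=
  eigenvalue_seq a b (dirichlet_schrodinger a b V) lam.

(* Main.v *)
Require Import Defs.
From HB Require Import structures.
From mathcomp Require Import all_boot all_order all_algebra.
From mathcomp Require Import all_classical all_reals all_analysis.
From mathcomp Require Import measurable_realfun.
From mathcomp Require Import ring lra.

Set Implicit Arguments.
Unset Strict Implicit.
Unset Printing Implicit Defensive.

Import Order.TTheory GRing.Theory Num.Theory.
Import numFieldNormedType.Exports.

Local Open Scope classical_set_scope.
Local Open Scope ring_scope.

(** For a real parameter [t], let [phi_t] and [psi_t] be the solutions of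
    [- y'' + V y = t y] on [[0, r]] whose data [(y, y')] at [0] are [(1, 0)] and
    [(0, 1)].  As [V] is even, the even extension of [phi_t] and the odd
    extension of [psi_t] span the solutions on [[- r, r]]
    ([symmetric_decomposition]).  Hence [t] is a Dirichlet eigenvalue iff
    [phi_t r = 0] or [psi_t r = 0], and a Neumann eigenvalue iff [phi_t' r = 0]
    or [psi_t' r = 0].

    The two problems are compared through one identity.  With [p = V - t], the
    product [phi' psi'] has the derivative [p (phi psi)'], so that
    [phi' c * psi' c] is the integral of [p (phi psi)'] over [[0, c]].  The
    function [phi psi] vanishes at [0] and is nonnegative up to the first zero
    of a factor; when [p] is monotone, summation by parts then bounds the
    integral by boundary terms, strictly if [p] is not constant on [(0, c)]
    ([monotone_by_parts], [monotone_by_parts_gap]).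

    (i) Let [V] be nonincreasing and [l = lam 1].  If [psi_l'] were nonnegative on
    [[0, r]], then [psi_l > 0] and so [phi_l r = 0]; at the first zero [c] of
    [phi_l] the left-hand side of the identity is nonpositive and the integral is
    positive, a contradiction ([sine_deriv_lt0]).  So [psi_l'] takes a negative
    value.  For very negative [t] it is positive on [[0, r]], hence there is a
    critical [s < l] for which [psi_s'] is nonnegative with a zero
    ([critical_parameter]), and this zero can only be [r]
    ([sine_deriv_zero_end]).  Thus [s] is a Neumann eigenvalue.  The Wronskian of
    [phi_s] and [psi_s] at [r] gives [phi_s' r < 0], whereas [phi_t' r > 0] for
    very negative [t], so there is a second Neumann eigenvalue below [s].  Two
    Neumann eigenvalues below [lam 1] give [mu 2 < lam 1].

    (ii) Let [V] be nondecreasing and [m = mu 2].  It is enough that [phi_m] takes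
    a negative value on [[0, r]]: then there is a critical [s < m] with [phi_s]
    nonnegative and [phi_s r = 0], so that [lam 1 <= s < m].  If [psi_m' r = 0],
    the identity at the first zero of [psi_m'] does it ([cosine_lt0]).  Otherwise
    [phi_m' r = 0] and [m] is simple, and a nonnegative [phi_m] would yield a
    positive Neumann eigenfunction; such an eigenfunction can only belong to the
    lowest eigenvalue, by Sturm comparison with an eigenfunction of [mu 1]
    ([neumann_positive_lowest], [even_neumann_sign_change]).

    The shooting arguments rest on the existence of [phi_t] and [psi_t] and on
    their Lipschitz dependence on [t] ([solution_on_exists],
    [solution_on_lip_dependence]); that they span all solutions follows from the
    constancy of Wronskians.  Since [V] is merely measurable
    and bounded, differentiation is replaced throughout by the relation
    [primitive_on] between a Lipschitz function and a bounded density. *)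

(** * Primitives of bounded measurable functions *)

Section Primitives.
Context {R : realType}.
Local Notation leb := (@lebesgue_measure R).
Implicit Types (a b c x y K : R) (F G H f g : R -> R).

Definition bounded_on a b f := exists K : R, forall x, a <= x <= b -> `|f x| <= K.

(** [F] is an indefinite integral of [f].  The condition is imposed for all pairs
    of points, so that it restricts to subintervals without a change of base
    point; as densities are bounded, primitives are Lipschitz. *)
Definition primitive_on a b F f : Prop :=
  [/\ measurable_fun `[a, b] f, bounded_on a b f &
      forall x y, a <= x -> x <= y -> y <= b ->
        F y - F x = \int[leb]_(t in `[x, y]) f t].

Lemma bounded_integrable_itv a b f :
  measurable_fun `[a, b] f -> bounded_on a b f ->
  leb.-integrable `[a, b] (EFin \o f).
Proof.
move=> mf [K Kf]; apply: measurable_bounded_integrable => //.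
  by rewrite /= lebesgue_measure_itv /=; case: ifP => // _; rewrite -EFinB ltry.
exists K; split; first exact: num_real.
by move=> M KM x /=; rewrite in_itv /= => /Kf /le_trans; apply; exact: ltW.
Qed.

Lemma subset_segment a b x y : a <= x -> y <= b -> `[x, y] `<=` `[a, b].
Proof.
move=> ax yb z /=; rewrite !in_itv /= => /andP[xz zy].
by rewrite (le_trans ax xz) (le_trans zy yb).
Qed.

Lemma primitive_on_sub a b x y F f : primitive_on a b F f ->
  a <= x -> y <= b -> primitive_on x y F f.
Proof.
move=> [mf [K Kf] Ff] ax yb; split.
- by apply: measurable_funS mf => //; exact: subset_segment.
- exists K => z /andP[xz zy].
  by apply: Kf; rewrite (le_trans ax xz) (le_trans zy yb).
- by move=> u v xu uv vy; apply: Ff => //; lra.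
Qed.

Lemma primitive_on_integrable a b F f : primitive_on a b F f ->
  leb.-integrable `[a, b] (EFin \o f).
Proof. by case=> mf bf _; exact: bounded_integrable_itv. Qed.

Lemma Rintegral_segment_open a b f : leb.-integrable `[a, b] (EFin \o f) ->
  \int[leb]_(t in `[a, b]) f t = \int[leb]_(t in `]a, b[) f t.
Proof.
move=> intf.
have io : leb.-integrable `]a, b] (EFin \o f).
  by apply: integrableS intf => //; exact: subset_itv_oc_cc.
rewrite -Rintegral_itv_obnd_cbnd// -Rintegral_itv_bndo_bndc//.
by apply: integrableS intf => //; exact: subset_itv_oo_cc.
Qed.

(** The comparison takes place on the open interval because signs and monotonicity
    of the potential are only controlled there. *)
Lemma primitive_on_le a b F f G g : a <= b ->
  primitive_on a b F f -> primitive_on a b G g ->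
  (forall x, a < x < b -> f x <= g x) -> F b - F a <= G b - G a.
Proof.
move=> ab pF pG fg.
have intf := primitive_on_integrable pF.
have intg := primitive_on_integrable pG.
case: pF => _ _ -> //; case: pG => _ _ -> //.
rewrite !Rintegral_segment_open //; apply: le_Rintegral => //.
- by apply: integrableS intf => //; exact: subset_itv_oo_cc.
- by apply: integrableS intg => //; exact: subset_itv_oo_cc.
Qed.

Lemma primitive_on_affine a b c k : primitive_on a b (fun x => c + k * x) (cst k).
Proof.
split.
- exact: measurable_cst.
- by exists `|k|.
- move=> x y ax xy yb; rewrite Rintegral_cst//= lebesgue_measure_itv /= lte_fin.
  case: ltgtP xy => // [xy _|-> _] /=; lra.
Qed.

Lemma eq_primitive_on a b F f G g : 
  (forall x, a <= x <= b -> F x = G x) -> (forall x, a <= x <= b -> f x = g x) ->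
  primitive_on a b F f -> primitive_on a b G g.
Proof.
move=> FG fg [mf [K Kf] Ff]; split.
- apply: eq_measurable_fun mf => x; rewrite inE /= in_itv /=; exact: fg.
- by exists K => x xab; rewrite -fg// Kf.
- move=> x y ax xy yb; rewrite -!FG ?Ff//; [|lra|lra].
  apply: eq_Rintegral => t; rewrite inE /= in_itv /= => /andP[xt ty].
  by apply: fg; lra.
Qed.

Lemma primitive_on_lin a b k l F f G g :
  primitive_on a b F f -> primitive_on a b G g ->
  primitive_on a b (fun x => k * F x + l * G x) (fun x => k * f x + l * g x).
Proof.
move=> pF pG; have [mf [K Kf] Ff] := pF; have [mg [L Lg] Gg] := pG; split.
- by apply: measurable_funD; apply: measurable_funM => //; exact: measurable_cst.
- exists (`|k| * K + `|l| * L) => x xab; apply: (le_trans (ler_normD _ _)).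
  by rewrite !normrM lerD// ler_wpM2l// ?Kf ?Lg.
- move=> x y ax xy yb.
  have iF := primitive_on_integrable (primitive_on_sub pF ax yb).
  have iG := primitive_on_integrable (primitive_on_sub pG ax yb).
  rewrite RintegralD//; last 2 first.
  + exact: (integrableZl _ k iF).
  + exact: (integrableZl _ l iG).
  by rewrite !RintegralZl// -Ff// -Gg//; lra.
Qed.

Definition lip_on a b K F :=
  forall x y, a <= x -> x <= y -> y <= b -> `|F y - F x| <= K * (y - x).

Lemma primitive_on_bound a b F f K : a <= b -> primitive_on a b F f ->
  (forall x, a < x < b -> `|f x| <= K) -> `|F b - F a| <= K * (b - a).
Proof.
move=> ab pF fK.
have up : F b - F a <= (0 + K * b) - (0 + K * a).
  apply: (primitive_on_le ab pF (primitive_on_affine a b 0 K)) => x /fK.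
  by rewrite ler_norml => /andP[].
have lo : (0 + - K * b) - (0 + - K * a) <= F b - F a.
  apply: (primitive_on_le ab (primitive_on_affine a b 0 (- K)) pF) => x /fK.
  by rewrite ler_norml => /andP[].
by rewrite ler_norml; apply/andP; split; lra.
Qed.

Lemma primitive_on_lip a b F f K : primitive_on a b F f ->
  (forall x, a <= x <= b -> `|f x| <= K) -> lip_on a b K F.
Proof.
move=> pF fK x y ax xy yb.
apply: (primitive_on_bound xy (primitive_on_sub pF ax yb)) => z xzy.
by apply: fK; lra.
Qed.

Lemma lip_onW a b K F : lip_on a b K F ->
  exists2 L : R, 0 <= L & lip_on a b L F.
Proof.
move=> KF; exists `|K| => // x y ax xy yb; apply: (le_trans (KF _ _ ax xy yb)).
by rewrite ler_wpM2r ?subr_ge0// ler_norm.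
Qed.

Lemma lip_on_bounded a b K F : lip_on a b K F -> bounded_on a b F.
Proof.
move=> /lip_onW [L L0 LF]; exists (`|F a| + L * `|b - a|) => x /andP[ax xb].
have := LF a x (lexx _) ax xb.
have -> : `|b - a| = b - a by rewrite ger0_norm// subr_ge0 (le_trans ax xb).
have := ler_normB (F x) (F a); rewrite -lerBlDr => _ H.
have : `|F x| <= `|F a| + `|F x - F a| by rewrite -{1}(subrK (F a) (F x)) addrC ler_normD.
have : L * (x - a) <= L * (b - a) by rewrite ler_wpM2l// lerD2r.
lra.
Qed.

Definition clamp a b x := Num.max a (Num.min b x).

Lemma clamp_id a b x : a <= x <= b -> clamp a b x = x.
Proof. by move=> /andP[ax xb]; rewrite /clamp min_r// max_r. Qed.

Lemma clamp_in a b x : a <= b -> a <= clamp a b x <= b.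
Proof.
by move=> ab; rewrite /clamp le_max lexx /= ge_max ab ge_min lexx.
Qed.

(** Composing with [clamp] extends a Lipschitz function on a segment to the whole
    line, where continuity and measurability are available. *)
Lemma clamp_continuous a b K F : a <= b -> lip_on a b K F ->
  continuous (F \o clamp a b).
Proof.
move=> ab /lip_onW [L L0 LF] x.
have LF' y z : `|F (clamp a b y) - F (clamp a b z)| <= L * `|y - z|.
  wlog zy : y z / z <= y.
    by move=> H; case/orP: (le_total z y) => [/H//|/H]; rewrite distrC (distrC z).
  have le : clamp a b z <= clamp a b y.
    by rewrite /clamp ge_max !le_max lexx /= orbC le_min !ge_min lexx zy !orbT.
  have /andP[za zb] := clamp_in z ab; have /andP[ya yb] := clamp_in y ab.
  apply: (le_trans (LF _ _ za le yb)).
  rewrite ler_wpM2l// ger0_norm ?subr_ge0//.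
  rewrite /clamp /Num.max /Num.min.
  by do ! (case: ifP => /=); lra.
apply/cvgrPdist_le => /= e e0; near=> z.
apply: (le_trans (LF' x z)).
have zx : `|x - z| <= e / (L + 1).
  near: z; exists (e / (L + 1)) => /=; first by rewrite divr_gt0//; lra.
  by move=> y /= /ltW.
apply: (@le_trans _ _ ((L + 1) * `|x - z|)); last by rewrite mulrC -ler_pdivlMr//; lra.
by rewrite ler_wpM2r//; lra.
Unshelve. all: by end_near. Qed.

Lemma lip_on_continuous a b K F : a <= b -> lip_on a b K F ->
  {within `[a, b], continuous F}.
Proof.
move=> ab KF.
apply: (@subspace_eq_continuous _ _ _ (F \o clamp a b)).
  by move=> x; rewrite inE /= in_itv /= => xab; rewrite clamp_id.
apply: continuous_subspaceT; exact: clamp_continuous KF.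
Qed.

Lemma lip_on_measurable a b K F : a <= b -> lip_on a b K F ->
  measurable_fun `[a, b] F.
Proof.
move=> ab KF.
by apply: subspace_continuous_measurable_fun => //; exact: lip_on_continuous KF.
Qed.

Lemma le_of_dyadic x y D : (forall n, x <= y + D / 2 ^+ n) -> x <= y.
Proof.
move=> H; apply/ler_addgt0Pr => e e0.
have [n De] : exists n, `|D| / e <= 2 ^+ n.
  exists (Num.bound (`|D| / e)).
  have D0 : 0 <= `|D| / e by rewrite divr_ge0 ?normr_ge0// ltW.
  apply: (le_trans (ltW (archi_boundP D0))).
  by rewrite -natrX ler_nat; apply: ltnW; exact: ltn_expl.
apply: (le_trans (H n)); rewrite lerD2l.
apply: (le_trans (_ : _ <= `|D| / 2 ^+ n)).
  by rewrite ler_wpM2r ?invr_ge0 ?exprn_ge0// ler_norm.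
by rewrite ler_pdivrMr ?exprn_gt0// mulrC -ler_pdivrMr.
Qed.

(** Bisection: halving the mesh halves the sum of the bounds on the increments.
    This plays the role of the fact that a function with zero derivative is
    constant. *)
Lemma eq_of_quadratic_increment a b H C : a <= b ->
  (forall x y, a <= x -> x <= y -> y <= b -> `|H y - H x| <= C * (y - x) ^+ 2) ->
  H b = H a.
Proof.
move=> ab HC.
have dyadic n : forall x y, a <= x -> x <= y -> y <= b ->
    `|H y - H x| <= C * (y - x) ^+ 2 / 2 ^+ n.
  elim: n => [|n IH] x y ax xy yb; first by rewrite expr0 divr1 HC.
  pose z := (x + y) / 2.
  have l := IH x z ax ltac:(rewrite /z; lra) ltac:(rewrite /z; lra).
  have r := IH z y ltac:(rewrite /z; lra) ltac:(rewrite /z; lra) yb.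
  have -> : H y - H x = (H z - H x) + (H y - H z) by ring.
  apply: (le_trans (ler_normD _ _)); apply: (le_trans (lerD l r)).
  rewrite [2 ^+ n.+1]exprS le_eqVlt; apply/orP; left; apply/eqP.
  by rewrite /z; field.
apply/eqP; rewrite -subr_eq0 -normr_le0.
apply: (@le_of_dyadic _ _ (C * (b - a) ^+ 2)) => n; rewrite add0r.
exact: dyadic.
Qed.

End Primitives.

(** * Calculus of primitives *)

Section PrimitiveCalculus.
Context {R : realType}.
Local Notation leb := (@lebesgue_measure R).
Implicit Types (a b c x y K : R) (F G H f g : R -> R).

Lemma primitive_on_integral a b c f :
  measurable_fun `[a, b] f -> bounded_on a b f ->
  primitive_on a b (fun x => c + \int[leb]_(t in `[a, x]) f t) f.
Proof.
move=> mf bf; split=> // x y ax xy yb.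
have int z : z <= b -> leb.-integrable `[a, z] (EFin \o f).
  move=> zb; apply: integrableS (bounded_integrable_itv mf bf) => //.
  exact: subset_segment.
rewrite opprD addrACA subrr add0r Rintegral_itvB ?bnd_simp//; last exact: int.
apply: Rintegral_itv_obnd_cbnd.
apply: integrableS (int y yb) => //.
by apply: subset_itv; rewrite bnd_simp.
Qed.

Lemma primitive_on_ex_lip a b F f : primitive_on a b F f ->
  exists2 L : R, 0 <= L & lip_on a b L F.
Proof.
move=> pF; have [_ [K Kf] _] := pF.
exact: lip_onW (primitive_on_lip pF Kf).
Qed.

Lemma bounded_on_ge0 a b f : bounded_on a b f ->
  exists2 K : R, 0 <= K & forall x, a <= x <= b -> `|f x| <= K.
Proof.
by move=> [K Kf]; exists `|K| => // x /Kf /le_trans; apply; exact: ler_norm.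
Qed.

(** Freezing one factor at an end of a short interval turns the defect of the
    product formula into an integral of increments, which is quadratic in the
    length by the Lipschitz bounds; [eq_of_quadratic_increment] concludes. *)
Lemma primitive_on_mul a b F f G g : a <= b ->
  primitive_on a b F f -> primitive_on a b G g ->
  primitive_on a b (fun x => F x * G x) (fun x => f x * G x + F x * g x).
Proof.
move=> ab pF pG; set h := fun x => f x * G x + F x * g x.
have [L L0 lF] := primitive_on_ex_lip pF; have [M M0 lG] := primitive_on_ex_lip pG.
have [mf bf _] := pF; have [mg bg _] := pG.
have [K K0 Kf] := bounded_on_ge0 bf; have [N N0 Ng] := bounded_on_ge0 bg.
have [KF KF0 KFF] := bounded_on_ge0 (lip_on_bounded lF).
have [KG KG0 KGG] := bounded_on_ge0 (lip_on_bounded lG).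
have mh : measurable_fun `[a, b] h.
  by apply: measurable_funD; apply: measurable_funM => //;
    [exact: lip_on_measurable lG | exact: lip_on_measurable lF].
have bh : bounded_on a b h.
  exists (K * KG + KF * N) => x xab; apply: (le_trans (ler_normD _ _)).
  by rewrite !normrM lerD// ler_pM// ?Kf ?KGG ?KFF ?Ng.
have pP := primitive_on_integral 0 mh bh.
set P := (fun x => _ + _) in pP.
split=> // x y ax xy yb.
have [_ _ <-//] := pP.
suff : F y * G y - P y = F x * G x - P x by lra.
pose H z := F z * G z - P z.
rewrite -/(H y) -/(H x).
apply: (@eq_of_quadratic_increment _ _ _ _ (K * M + L * N)) => // u v xu uv vy.
have au := le_trans ax xu; have vb := le_trans vy yb.
have pF' := primitive_on_sub pF au vb; have pG' := primitive_on_sub pG au vb.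
have pP' := primitive_on_sub pP au vb.
have lin := primitive_on_lin 1 (-1) (primitive_on_lin (G v) (F u) pF' pG') pP'.
have := primitive_on_bound (K := (K * M + L * N) * (v - u)) uv lin.
have -> : H v - H u = (1 * (G v * F v + F u * G v) + -1 * P v) - (1 * (G v * F u + F u * G u) + -1 * P u).
  by rewrite /H; ring.
rewrite expr2 mulrA; apply=> t /andP[ut tv].
have -> : 1 * (G v * f t + F u * g t) + -1 * h t = f t * (G v - G t) - (F t - F u) * g t.
  by rewrite /h; ring.
apply: (le_trans (ler_normB _ _)); rewrite [leRHS]mulrDl !normrM lerD//.
- rewrite -mulrA ler_pM//; first by apply: Kf; lra.
  apply: (le_trans (lG t v _ _ _)); [lra|lra|lra|].
  by rewrite ler_wpM2l//; lra.
- rewrite mulrAC ler_pM//; last by apply: Ng; lra.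
  apply: (le_trans (lF u t _ _ _)); [lra|lra|lra|].
  by rewrite ler_wpM2l//; lra.
Qed.

Lemma primitive_on_const a b F : a <= b -> primitive_on a b F (fun=> 0) ->
  F b = F a.
Proof.
move=> ab pF; apply/eqP; rewrite -subr_eq0 -normr_le0.
have := primitive_on_bound ab pF (K := 0); rewrite mul0r; apply=> *.
by rewrite normr0.
Qed.

Lemma primitive_on_nondecreasing a b F f : a <= b -> primitive_on a b F f ->
  (forall x, a < x < b -> 0 <= f x) -> F a <= F b.
Proof.
move=> ab pF f0.
by have := primitive_on_le ab (primitive_on_affine a b 0 0) pF f0; lra.
Qed.

(** A nonnegative density that is positive at one point and Lipschitz stays
    bounded below on a subinterval of positive length. *)
Lemma primitive_on_lt a b F f x0 : a < b -> primitive_on a b F f ->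
  (exists K : R, lip_on a b K f) ->
  (forall x, a <= x <= b -> 0 <= f x) -> a <= x0 <= b -> 0 < f x0 -> F a < F b.
Proof.
move=> ab pF [K /lip_onW [L L0 Lf]] f0 /andP[ax xb] fx0.
(* [f >= f x0 / 2] on the part of [[a, b]] within [d] of [x0] *)
pose d := f x0 / (2 * (L + 1)).
have d0 : 0 < d by rewrite divr_gt0// mulr_gt0//; lra.
have Ld : L * d <= f x0 / 2.
  have -> : f x0 / 2 = (L + 1) * d by rewrite /d; field; lra.
  by rewrite ler_pM2r//; lra.
pose u := Num.max a (x0 - d); pose v := Num.min b (x0 + d).
have ua : a <= u by rewrite /u le_max lexx.
have vb : v <= b by rewrite /v ge_min lexx.
have ux : x0 - d <= u by rewrite /u le_max lexx orbT.
have vx : v <= x0 + d by rewrite /v ge_min lexx orbT.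
have uv : u < v.
  by rewrite /u /v gt_max !lt_min; apply/andP; split; apply/andP; split; lra.
have big x : u < x < v -> f x0 / 2 <= f x.
  move=> /andP[ux' xv].
  have : `|f x - f x0| <= L * d.
    case/orP: (le_total x x0) => xx0.
      rewrite distrC; apply: (le_trans (Lf x x0 _ _ _)); [lra|lra|lra|].
      by rewrite ler_wpM2l//; lra.
    apply: (le_trans (Lf x0 x _ _ _)); [lra|lra|lra|].
    by rewrite ler_wpM2l//; lra.
  by rewrite ler_norml => /andP[]; lra.
have pos x y : a <= x -> x <= y -> y <= b -> F x <= F y.
  move=> ax' xy yb; apply: (primitive_on_nondecreasing xy (primitive_on_sub pF ax' yb)).
  by move=> z ?; apply: f0; lra.
have := primitive_on_le (ltW uv) (primitive_on_affine u v 0 (f x0 / 2)) (primitive_on_sub pF ua vb) big.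
have := pos a u (lexx _) ua (le_trans (ltW uv) vb).
have := pos v b (le_trans ua (ltW uv)) vb (lexx _).
have : 0 < f x0 / 2 * (v - u) by rewrite mulr_gt0; lra.
lra.
Qed.

Lemma primitive_on_glue a c b F f : a <= c -> c <= b ->
  primitive_on a c F f -> primitive_on c b F f -> primitive_on a b F f.
Proof.
move=> ac cb p1 p2.
have [m1 [K1 Kf1] F1] := p1; have [m2 [K2 Kf2] F2] := p2.
have mf : measurable_fun `[a, b] f.
  have -> : `[a, b]%classic = `[a, c]%classic `|` `[c, b]%classic.
    apply/seteqP; split=> x /=; rewrite !in_itv /=; last by case=> ?; lra.
    by case: (lerP x c) => ? ?; [left|right]; lra.
  exact/measurable_funU.
have bf : bounded_on a b f.
  exists (Num.max K1 K2) => x xab; rewrite le_max.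
  by case: (lerP x c) => ?; apply/orP; [left; apply: Kf1 | right; apply: Kf2]; lra.
split=> // x y ax xy yb.
case: (lerP y c) => yc; first exact: F1.
case: (lerP c x) => cx; first exact: F2.
have [_ _ Pf] := primitive_on_integral 0 mf bf.
rewrite -Pf//.
have h1 := F1 x c ax (ltW cx) (lexx _); rewrite -Pf in h1 => //; last lra.
have h2 := F2 c y (lexx _) (ltW yc) yb; rewrite -Pf in h2 => //; last lra.
lra.
Qed.

End PrimitiveCalculus.

(** * Reflection *)

Section PrimitiveReflection.
Context {R : realType}.
Local Notation leb := (@lebesgue_measure R).
Implicit Types (a b c x y K : R) (F G H f g : R -> R).

Lemma measurable_reflect a b f : measurable_fun `[a, b] f ->
  measurable_fun `[- b, - a] (f \o -%R).
Proof.
move=> mf; apply: (@measurable_comp _ _ _ _ _ _ `[a, b]%classic) => //.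
move=> y [z /= zab <-]; move: zab; rewrite /= !in_itv /= => zab; lra.
Qed.

(** Lebesgue measure is invariant under reflection; the density is cut off outside
    the segment because the change of variables requires it to be measurable on
    the whole line. *)
Lemma Rintegral_reflect a b f : measurable_fun `[a, b] f -> bounded_on a b f ->
  \int[leb]_(t in `[- b, - a]) f (- t) = \int[leb]_(t in `[a, b]) f t.
Proof.
move=> mf [K Kf].
have mD : measurable `[a, b]%classic by [].
pose g := (EFin \o f) \_ `[a, b].
have mg : measurable_fun [set: measurableTypeR R] g.
  apply: (iffLR (measurable_restrictT (EFin \o f) mD)).
  exact/measurable_EFinP.
have preim : (-%R : _ -> measurableTypeR R) @^-1` `[a, b] = `[- b, - a]%classic.
  by rewrite opp_preimage_itvbndbnd.
have intg : leb.-integrable ((-%R : _ -> measurableTypeR R) @^-1` `[a, b]) (g \o -%R).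
  rewrite preim; have : leb.-integrable `[- b, - a] (EFin \o (f \o -%R)).
    apply: bounded_integrable_itv; first exact: measurable_reflect.
    by exists K => x xab /=; apply: Kf; lra.
  apply: eq_integrable => // x; rewrite inE /= in_itv /= => xab.
  by rewrite /g patchE ifT// inE /= in_itv /=; lra.
have mopp : measurable_fun [set: measurableTypeR R] (-%R : _ -> measurableTypeR R).
  exact: oppr_measurable.
have := integral_pushforward mopp mg intg mD.
rewrite preim => e.
pose I : set R := `[a, b]%classic; pose J : set R := `[- b, - a]%classic.
have : (\int[leb]_(y in I) g y = \int[leb]_(x in J) (g \o -%R) x)%E.
  rewrite -e; apply: eq_measure_integral => A mA _.
  exact/esym/lebesgue_measureN.
move=> {}e; rewrite /Rintegral; congr fine; move: e.
have -> : (\int[leb]_(y in I) g y = \int[leb]_(t in I) (f t)%:E)%E.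
  by apply: eq_integral => t tab; rewrite /g patchE tab.
move=> ->; apply: eq_integral => t; rewrite inE /= in_itv /= => tab.
by rewrite /g patchE ifT// inE /= in_itv /=; lra.
Qed.

Lemma primitive_on_reflect a b F f : primitive_on a b F f ->
  primitive_on (- b) (- a) (fun x => F (- x)) (fun x => - f (- x)).
Proof.
move=> pF; have [mf [K Kf] Ff] := pF; split.
- exact: (measurable_funN (measurable_reflect mf)).
- by exists K => x xab; rewrite normrN; apply: Kf; lra.
- move=> x y ax xy yb.
  have ay : a <= - y by lra.
  have xb : - x <= b by lra.
  have [mf' bf' _] := primitive_on_sub pF ay xb.
  have e : \int[leb]_(t in `[x, y]) (f \o -%R) t = F (- x) - F (- y).
    rewrite -[X in `[X, _]]opprK -[X in `[_, X]]opprK Rintegral_reflect.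
    + by rewrite Ff//; lra.
    + exact: mf'.
    + exact: bf'.
  under eq_Rintegral do rewrite -mulN1r.
  rewrite RintegralZl//; first by rewrite [X in _ * X]e; lra.
  apply: bounded_integrable_itv.
  + rewrite -[X in `[X, _]]opprK -[X in `[_, X]]opprK.
    exact: measurable_reflect.
  + by exists K => z ?; apply: Kf; lra.
Qed.

End PrimitiveReflection.

(** * Integration by parts against a monotone function *)

Section MonotoneByParts.
Context {R : realType}.
Implicit Types (a b c x y K p : R) (F G H f g : R -> R).

(** Formally, this is the integration by parts
    [\int p d(f - m) = [p (f - m)] - \int (f - m) dp] followed by [dp >= 0] and
    [f >= m].  On an interval where [p] varies between [A] and [B], the inequality
    holds up to an error [(B - A) * K * length], where [K] bounds [g]; bisecting
    at [z] with the intermediate bound [p z] halves the total error, because the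
    oscillations of [p] add up. *)
Lemma monotone_by_parts a b (p : R -> R) f g H A B m : a < b ->
  primitive_on a b f g -> primitive_on a b H (fun x => p x * g x) ->
  (forall x y, a < x -> x <= y -> y < b -> p x <= p y) ->
  (forall x, a < x < b -> A <= p x <= B) ->
  (forall x, a <= x <= b -> m <= f x) ->
  H b - H a <= B * (f b - m) - A * (f a - m).
Proof.
move=> ab pf pH pmon pAB fm.
have [_ bg _] := pf; have [K K0 Kg] := bounded_on_ge0 bg.
have dyadic n : forall x y A B, a <= x -> x < y -> y <= b ->
    (forall t, x < t < y -> A <= p t <= B) ->
    H y - H x <= B * (f y - m) - A * (f x - m) + (B - A) * K * (y - x) / 2 ^+ n.
  elim: n => [|n IH] x y A' B' ax xy yb pAB'.
    rewrite expr0 divr1.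
    have pf' := primitive_on_sub pf ax yb; have pH' := primitive_on_sub pH ax yb.
    have := primitive_on_le (ltW xy) (primitive_on_lin 1 (- B') pH' pf')
      (primitive_on_affine x y 0 ((B' - A') * K)).
    have AB : 0 <= B' - A' by have := pAB' ((x + y) / 2) ltac:(lra); lra.
    have le t : x < t < y -> 1 * (p t * g t) + - B' * g t <= (B' - A') * K.
      move=> xty; have -> : 1 * (p t * g t) + - B' * g t = (B' - p t) * - g t by ring.
      have := pAB' t xty => /andP[h1 h2].
      apply: (@le_trans _ _ ((B' - p t) * K)).
        rewrite ler_wpM2l ?subr_ge0//.
        have := Kg t ltac:(lra); rewrite ler_norml; lra.
      by rewrite ler_wpM2r//; lra.
    move=> /(_ le).
    have : 0 <= (B' - A') * (f x - m).
      by rewrite mulr_ge0// subr_ge0; apply: fm; lra.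
    lra.
  pose z := (x + y) / 2.
  have xz : x < z by rewrite /z; lra.
  have zy : z < y by rewrite /z; lra.
  have l := IH x z A' (p z) ax xz ltac:(lra).
  have r := IH z y (p z) B' ltac:(lra) zy yb.
  have l' : forall t, x < t < z -> A' <= p t <= p z.
    move=> t xtz; have := pAB' t ltac:(lra); have := pmon t z; lra.
  have r' : forall t, z < t < y -> p z <= p t <= B'.
    move=> t xtz; have := pAB' t ltac:(lra); have := pmon z t; lra.
  have {}l := l l'; have {}r := r r'.
  have -> : (B' - A') * K * (y - x) / 2 ^+ n.+1 =
     (p z - A') * K * (z - x) / 2 ^+ n + (B' - p z) * K * (y - z) / 2 ^+ n.
    by rewrite [2 ^+ n.+1]exprS /z; field.
  lra.
apply: (@le_of_dyadic _ _ _ ((B - A) * K * (b - a))) => n.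
exact: dyadic.
Qed.

(** Applying [monotone_by_parts] on [[a, x1]], [[x1, x2]] and [[x2, b]] with the
    lower bounds [0], [m] and [0] makes the boundary terms telescope and leaves
    the increase of [p] over [[x1, x2]], weighted by [m]. *)
Lemma monotone_by_parts_gap a b (p : R -> R) f g H A B m x1 x2 :
  primitive_on a b f g -> primitive_on a b H (fun x => p x * g x) ->
  (forall x y, a < x -> x <= y -> y < b -> p x <= p y) ->
  (forall x, a < x < b -> A <= p x <= B) ->
  (forall x, a <= x <= b -> 0 <= f x) ->
  a < x1 -> x1 < x2 -> x2 < b ->
  (forall x, x1 <= x <= x2 -> m <= f x) ->
  H b - H a <= B * f b - A * f a - m * (p x2 - p x1).
Proof.
move=> pf pH pmon pAB f0 ax1 x12 x2b fm.
have part u v A' B' m' : a <= u -> u < v -> v <= b ->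
    (forall x, u < x < v -> A' <= p x <= B') ->
    (forall x, u <= x <= v -> m' <= f x) ->
    H v - H u <= B' * (f v - m') - A' * (f u - m').
  move=> au uv vb pAB' fm'.
  apply: (monotone_by_parts uv (primitive_on_sub pf au vb) (primitive_on_sub pH au vb)) => //.
  by move=> x y ux xy yv; apply: pmon => //; lra.
have h1 : H x1 - H a <= p x1 * (f x1 - 0) - A * (f a - 0).
  apply: part; [lra|lra|lra| |].
  - by move=> x axx; have := pAB x ltac:(lra); have := pmon x x1; lra.
  - by move=> x axx; apply: f0; lra.
have h2 : H x2 - H x1 <= p x2 * (f x2 - m) - p x1 * (f x1 - m).
  apply: part; [lra|lra|lra| |exact: fm].
  by move=> x axx; have := pmon x x2; have := pmon x1 x; lra.
have h3 : H b - H x2 <= B * (f b - 0) - p x2 * (f x2 - 0).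
  apply: part; [lra|lra|lra| |].
  - by move=> x axx; have := pAB x ltac:(lra); have := pmon x2 x; lra.
  - by move=> x axx; apply: f0; lra.
lra.
Qed.

End MonotoneByParts.

(** * First zeros and critical parameters *)

Section Zeros.
Context {R : realType}.
Local Notation leb := (@lebesgue_measure R).
Implicit Types (a b c x y K : R) (F G H f g : R -> R).

Lemma first_zero a x K g : a <= x -> lip_on a x K g -> 0 < g a -> g x <= 0 ->
  exists c, [/\ a < c, c <= x, g c = 0 & forall y, a <= y < c -> 0 < g y].
Proof.
move=> ax /lip_onW [L L0 Lg] ga gx.
pose E := [set y | a <= y <= x /\ forall z, a <= z <= y -> 0 < g z].
have Ea : E a by split; [rewrite lexx | move=> z /andP[az za]; have -> : z = a by lra].
have supE : has_sup E by split; [exists a | exists x => y [/andP[]]].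
pose s := sup E.
have ub y : E y -> y <= s by move=> Ey; exact: (sup_upper_bound supE).
have as_ : a <= s by exact: ub.
have sx : s <= x by apply: ge_sup; [exists a | move=> y [/andP[]]].
have pos y : a <= y < s -> 0 < g y.
  move=> /andP[ay ys]; have [e Ee] := sup_adherent (ltac:(lra) : 0 < s - y) supE.
  by rewrite subKr => ye; case: Ee => _; apply; lra.
have gs : g s = 0.
  apply/eqP; rewrite eq_le; apply/andP; split; rewrite leNgt; apply/negP => gs.
  - have sx' : s < x.
      by rewrite lt_neqAle sx andbT; apply/eqP => e; move: gs; rewrite e; lra.
    pose d := g s / (2 * (L + 1)).
    have d0 : 0 < d by rewrite divr_gt0// mulr_gt0//; lra.
    have Ld : L * d < g s.
      have -> : g s = 2 * (L + 1) * d by rewrite /d; field; lra.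
      by rewrite ltr_pM2r//; lra.
    pose y := Num.min x (s + d).
    have yx : y <= x by rewrite /y ge_min lexx.
    have yd : y <= s + d by rewrite /y ge_min lexx orbT.
    have sy : s < y by rewrite /y lt_min sx'; lra.
    have : E y.
      split; first lra.
      move=> z /andP[az zy]; case: (ltP z s) => zs; first by apply: pos; lra.
      have := Lg s z as_ zs (le_trans zy yx); rewrite ler_norml => /andP[+ _].
      have : L * (z - s) <= L * d by rewrite ler_wpM2l//; lra.
      lra.
    by move=> /ub; lra.
  - have as' : a < s.
      by rewrite lt_neqAle as_ andbT; apply/eqP => e; move: gs; rewrite -e; lra.
    pose d := - g s / (2 * (L + 1)).
    have d0 : 0 < d by rewrite divr_gt0// ?mulr_gt0//; lra.
    have Ld : L * d < - g s.
      have -> : - g s = 2 * (L + 1) * d by rewrite /d; field; lra.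
      by rewrite ltr_pM2r//; lra.
    pose y := Num.max a (s - d).
    have ya : a <= y by rewrite /y le_max lexx.
    have yd : s - d <= y by rewrite /y le_max lexx orbT.
    have ys : y < s by rewrite /y gt_max as'; lra.
    have := Lg y s ya (ltW ys) sx; rewrite ler_norml => /andP[+ _].
    have : L * (s - y) <= L * d by rewrite ler_wpM2l//; lra.
    have := pos y ltac:(lra); lra.
exists s; split => //; rewrite lt_neqAle as_ andbT; apply/eqP => e.
by move: ga; rewrite e gs ltxx.
Qed.

Lemma lip_on_min a b K f : a <= b -> lip_on a b K f ->
  exists2 c, a <= c <= b & forall x, a <= x <= b -> f c <= f x.
Proof.
move=> ab /(lip_on_continuous ab) cf; have [c] := EVT_min ab cf.
by rewrite in_itv /= => ? cmin; exists c => // x xab; apply: cmin; rewrite in_itv.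
Qed.

(** The minimum over [[a, b]] of [g s] is a Lipschitz function of the parameter
    [s], so it has a first zero on the way from a positive to a negative value. *)
Lemma critical_parameter a b s0 s1 (g : R -> R -> R) C : a <= b -> s0 <= s1 ->
  (forall s, s0 <= s <= s1 -> exists K, lip_on a b K (g s)) ->
  (forall x, a <= x <= b -> lip_on s0 s1 C (g^~ x)) ->
  (forall x, a <= x <= b -> 0 < g s0 x) ->
  (exists2 x, a <= x <= b & g s1 x < 0) ->
  exists s, [/\ s0 < s < s1, forall x, a <= x <= b -> 0 <= g s x &
    exists2 x, a <= x <= b & g s x = 0].
Proof.
move=> ab s01 lipx lips g0 [x1 x1ab gx1].
have /choice[c cP] : forall s, exists c, s0 <= s <= s1 ->
    a <= c <= b /\ forall x, a <= x <= b -> g s c <= g s x.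
  move=> s; have [s01s|?] := boolP (s0 <= s <= s1); last by exists 0.
  have [K Kg] := lipx _ s01s; have [c ? ?] := lip_on_min ab Kg.
  by exists c.
pose m s := g s (c s).
have lipm : lip_on s0 s1 C m.
  move=> s t s0s st ts1.
  have [cs ms] := cP s ltac:(lra); have [ct mt] := cP t ltac:(lra).
  have := lips _ cs s t s0s st ts1; have := lips _ ct s t s0s st ts1.
  rewrite !ler_norml /m.
  have := ms _ ct; have := mt _ cs; lra.
have m0 : 0 < m s0 by apply: g0; have [] := cP s0 ltac:(lra).
have m1 : m s1 < 0.
  by have [_ /(_ _ x1ab)] := cP s1 ltac:(lra); rewrite /m; lra.
have [s [s0s ss1 ms _]] := first_zero s01 lipm m0 (ltW m1).
have [cs mins] := cP s ltac:(lra).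
exists s; split.
- rewrite s0s lt_neqAle ss1 andbT; apply/eqP => e.
  by move: m1; rewrite -e ms ltxx.
- by move=> x xab; rewrite -ms; exact: mins.
- by exists (c s).
Qed.

Lemma deriv_le0_at_zero a c F f : a < c -> primitive_on a c F f ->
  (exists K, lip_on a c K f) -> (forall x, a <= x <= c -> 0 <= F x) -> F c = 0 ->
  f c <= 0.
Proof.
move=> ac pF [K /lip_onW [L L0 Lf]] F0 Fc; rewrite leNgt; apply/negP => fc.
pose d := f c / (2 * (L + 1)).
have d0 : 0 < d by rewrite divr_gt0// mulr_gt0//; lra.
have Ld : L * d < f c.
  have -> : f c = 2 * (L + 1) * d by rewrite /d; field; lra.
  by rewrite ltr_pM2r//; lra.
pose y := Num.max a (c - d).
have ya : a <= y by rewrite /y le_max lexx.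
have yd : c - d <= y by rewrite /y le_max lexx orbT.
have ys : y < c by rewrite /y gt_max ac; lra.
have := primitive_on_le (ltW ys) (primitive_on_affine y c 0 (f c - L * d)) (primitive_on_sub pF ya (lexx _)).
have h x : y < x < c -> cst (f c - L * d) x <= f x.
  move=> yxc; have := Lf x c ltac:(lra) ltac:(lra) (lexx _).
  rewrite ler_norml => /andP[_].
  have : L * (c - x) <= L * d by rewrite ler_wpM2l//; lra.
  by rewrite /=; lra.
move=> /(_ h).
have := F0 y ltac:(lra).
have : 0 < (f c - L * d) * (c - y) by rewrite mulr_gt0//; lra.
by rewrite Fc; lra.
Qed.

(** The integral of [u ^+ 2] vanishes, so by [primitive_on_lt] the continuous
    function [u ^+ 2] cannot be positive anywhere. *)
Lemma lip_on_ae_eq0 a b K u : a < b -> lip_on a b K u ->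
  ae_eq leb `]a, b[%classic u (fun=> 0) -> forall x, a <= x <= b -> u x = 0.
Proof.
move=> ab lu u0 x xab; apply/eqP/negPn/negP => ux.
have mu := lip_on_measurable (ltW ab) lu.
have [K' K0 Ku] := bounded_on_ge0 (lip_on_bounded lu).
have m2 : measurable_fun `[a, b] (fun x => u x * u x) by exact: measurable_funM.
have b2 : bounded_on a b (fun x => u x * u x).
  by exists (K' * K') => z zab; rewrite normrM ler_pM// Ku.
have l2 : exists K, lip_on a b K (fun x => u x * u x).
  have [L L0 Lu] := lip_onW lu; exists (2 * K' * L) => y z ay yz zb.
  have -> : u z * u z - u y * u y = (u z + u y) * (u z - u y) by ring.
  rewrite normrM -mulrA ler_pM//; last exact: Lu.
  apply: (le_trans (ler_normD _ _)).
  by have := Ku z ltac:(lra); have := Ku y ltac:(lra); lra.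
have pP := primitive_on_integral 0 m2 b2.
have := primitive_on_lt ab pP l2 (fun z _ => sqr_ge0 (u z)) xab.
rewrite -expr2 exprn_even_gt0//= => /(_ ux); rewrite ltNge => /negP; apply.
rewrite -subr_le0; have [_ _ ->//] := pP; last exact: ltW.
rewrite Rintegral_segment_open; last exact: bounded_integrable_itv.
rewrite /Rintegral (@ae_eq_integral _ _ _ leb _ (cst 0%E)) ?integral0//.
- apply/measurable_EFinP; apply: measurable_funS m2 => //.
  exact: subset_itv_oo_cc.
- apply: filterS u0 => z /= uz zab.
  by rewrite uz// mulr0.
Qed.

End Zeros.

(** * The initial value problem for [y'' = p y] *)

Section Picard.
Context {R : realType}.
Local Notation leb := (@lebesgue_measure R).
Implicit Types (a b c x y K L r : R) (F G H f g p q : R -> R).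

(** A solution of [y'' = p y], written as the system [y' = y1], [y1' = p y]. *)
Definition solution_on a b p (y y1 : R -> R) : Prop :=
  primitive_on a b y y1 /\ primitive_on a b y1 (fun x => p x * y x).

Lemma primitive_on_expR a b L : 0 < L -> a <= b ->
  primitive_on a b (fun x => expR (L * x) / L) (fun x => expR (L * x)).
Proof.
move=> L0 ab.
have dF x : is_derive x (1:R) (fun x : R => expR (L * x) / L) (expR (L * x)).
  have -> : (fun x : R => expR (L * x) / L) = (fun x => L^-1 *: expR (L * x)).
    by apply/funext => y; rewrite mulrC.
  apply: is_derive_eq.
  by rewrite /GRing.scale /=; field; lra.
have cf : continuous (fun x : R => expR (L * x)).
  move=> x; apply: (continuous_comp (f := fun x : R => L * x)).
    exact: mulrl_continuous.
  exact: continuous_expR.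
have cF : continuous (fun x : R => expR (L * x) / L).
  by move=> x; apply/differentiable_continuous/derivable1_diffP; case: (dF x).
split.
- by apply: measurable_funTS; exact: continuous_measurable_fun.
- exists (expR (L * b)) => x xab; rewrite ger0_norm ?expR_ge0// ler_expR.
  by rewrite ler_pM2l//; lra.
- move=> x y ax xy yb; move: xy; rewrite le_eqVlt => /orP[/eqP ->|xy].
    by rewrite set_itv1 Rintegral_set1 subrr.
  rewrite /Rintegral (@continuous_FTC2 _ _ (fun x : R => expR (L * x) / L))//.
  - by apply: continuous_subspaceT => z; exact: cf.
  - split; [by move=> z _; case: (dF z)| |].
      by apply: cvg_at_right_filter; exact: cF.
    by apply: cvg_at_left_filter; exact: cF.
  - by move=> z _; rewrite derive1E; case: (dF z).
Qed.

(** Integration gains a factor [1 / L] in the sup norm weighted by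
    [expR (- L * x)]; for [L] large this makes the Picard operator a contraction on
    all of [[0, r]]. *)
Lemma primitive_on_exp_bound r L c F f x : 0 < L -> primitive_on 0 r F f ->
  0 <= x <= r -> (forall s, 0 <= s <= r -> `|f s| <= c * expR (L * s)) ->
  `|F x - F 0| <= c / L * (expR (L * x) - 1).
Proof.
move=> L0 pF /andP[x0 xr] fc.
have pF' := primitive_on_sub pF (lexx _) xr.
have pe := primitive_on_expR L0 x0.
have up := primitive_on_le x0 pF' (primitive_on_lin c 0 pe pe).
have lo := primitive_on_le x0 (primitive_on_lin (- c) 0 pe pe) pF'.
have h1 s : 0 < s < x -> f s <= c * expR (L * s) + 0 * expR (L * s).
  by move=> sx; have := fc s ltac:(lra); rewrite ler_norml; lra.
have h2 s : 0 < s < x -> - c * expR (L * s) + 0 * expR (L * s) <= f s.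
  by move=> sx; have := fc s ltac:(lra); rewrite ler_norml; lra.
have {}up := up h1; have {}lo := lo h2; move: up lo.
rewrite mulr0 expR0 ler_norml => up lo.
by apply/andP; split; lra.
Qed.

Lemma primitive_on_limit a b (F_ f_ : nat -> R -> R) F f K : a <= b ->
  (forall n, primitive_on a b (F_ n) (f_ n)) ->
  (forall n x, a <= x <= b -> `|F_ n x - F x| <= K / 2 ^+ n) ->
  (forall n x, a <= x <= b -> `|f_ n x - f x| <= K / 2 ^+ n) ->
  measurable_fun `[a, b] f -> primitive_on a b F f.
Proof.
move=> ab pF FF ff mf.
have bf : bounded_on a b f.
  have [_ [C Cf] _] := pF 0%N; exists (C + K) => x xab.
  have := ff 0%N x xab; rewrite expr0 divr1 distrC => h.
  have -> : f x = f_ 0%N x + (f x - f_ 0%N x) by ring.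
  by apply: (le_trans (ler_normD _ _)); rewrite lerD// Cf.
split=> // x y ax xy yb.
pose G z := 0 + \int[leb]_(t in `[a, z]) f t.
have pG : primitive_on a b G f := primitive_on_integral 0 mf bf.
have [_ _ <- //] := pG.
apply/eqP; rewrite -subr_eq0 -normr_le0.
apply: (@le_of_dyadic _ _ _ (2 * K + K * (y - x))) => n; rewrite add0r.
have := primitive_on_bound (K := K / 2 ^+ n) xy
  (primitive_on_sub (primitive_on_lin 1 (-1) (pF n) pG) ax yb).
have h t : x < t < y -> `|1 * f_ n t + -1 * f t| <= K / 2 ^+ n.
  move=> xty; have -> : 1 * f_ n t + -1 * f t = f_ n t - f t by ring.
  by apply: ff; lra.
move=> /(_ h).
have := FF n x ltac:(lra); have := FF n y ltac:(lra).
rewrite !ler_norml => /andP[h1 h2] /andP[h3 h4] /andP[h5 h6].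
by apply/andP; split; lra.
Qed.

Lemma geometric_limit (u : nat -> R) D :
  (forall n, `|u n.+1 - u n| <= D / 2 ^+ n) ->
  exists l, forall n, `|u n - l| <= 2 * D / 2 ^+ n.
Proof.
move=> uD.
pose lo n := u n - 2 * D / 2 ^+ n; pose hi n := u n + 2 * D / 2 ^+ n.
have half n : D / 2 ^+ n = 2 * D / 2 ^+ n.+1.
  by rewrite [2 ^+ n.+1]exprS; field.
have dbl n : 2 * D / 2 ^+ n = 2 * D / 2 ^+ n.+1 + 2 * D / 2 ^+ n.+1.
  by rewrite [2 ^+ n.+1]exprS; field.
have lohi m n : lo m <= hi n.
  have lo_nd : {homo lo : i j / (i <= j)%N >-> i <= j}.
    apply: homo_leq => [x|y x z|i]; [exact: lexx|exact: le_trans|].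
    have := uD i; rewrite ler_norml half /lo (dbl i); lra.
  have hi_ni : {homo hi : i j / (i <= j)%N >-> j <= i}.
    apply: homo_leq => [x|y x z h1 h2|i]; [exact: lexx|exact: le_trans h2 h1|].
    have := uD i; rewrite ler_norml half /hi (dbl i); lra.
  apply: (le_trans (lo_nd _ _ (leq_maxl m n))).
  apply: (le_trans _ (hi_ni _ _ (leq_maxr m n))).
  have : 0 <= 2 * D / 2 ^+ maxn m n.
    by rewrite -mulrA mulr_ge0// (le_trans _ (uD (maxn m n))).
  by rewrite /lo /hi; lra.
exists (sup (range lo)) => n.
have ne : range lo !=set0 by exists (lo 0%N), 0%N.
have h1 : sup (range lo) <= hi n.
  by apply: ge_sup => // _ [m _ <-].
have h2 : lo n <= sup (range lo).
  apply: sup_upper_bound; last by exists n.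
  by split => //; exists (hi 0%N) => _ [m _ <-].
by move: h1 h2; rewrite /lo /hi ler_norml; lra.
Qed.

(** In the weighted norm, a bound [A] on the difference of the two solutions
    improves to [(A + d) / 2]; iterating from the crude bound [2 + d] yields [d]. *)
Lemma solution_on_lip_dependence r L p q (y y1 z z1 : R -> R) d : 2 <= L ->
  solution_on 0 r p y y1 -> solution_on 0 r q z z1 ->
  y 0 = z 0 -> y1 0 = z1 0 ->
  (forall x, 0 <= x <= r -> `|p x| <= L / 2) ->
  (forall x, 0 <= x <= r -> `|p x - q x| <= d) ->
  (forall x, 0 <= x <= r -> `|y x| <= expR (L * x) /\ `|y1 x| <= expR (L * x)) ->
  (forall x, 0 <= x <= r -> `|z x| <= expR (L * x) /\ `|z1 x| <= expR (L * x)) ->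
  forall x, 0 <= x <= r ->
   `|y x - z x| <= d * expR (L * x) /\ `|y1 x - z1 x| <= d * expR (L * x).
Proof.
move=> L2 [py py1] [pz pz1] yz0 yz1 pL pq by_ bz.
have iter n : forall x, 0 <= x <= r ->
    `|y x - z x| <= (2 / 2 ^+ n + d) * expR (L * x) /\
    `|y1 x - z1 x| <= (2 / 2 ^+ n + d) * expR (L * x).
  elim: n => [|n IH] x xr; set e := expR (L * x).
    have d0 : 0 <= d by exact: le_trans (normr_ge0 _) (pq _ xr).
    have e0 : 0 <= d * e by rewrite mulr_ge0// expR_ge0.
    rewrite expr0 divr1.
    have [h1 h2] := by_ _ xr; have [h3 h4] := bz _ xr; rewrite -/e in h1 h2 h3 h4.
    split; apply: (le_trans (ler_normB _ _)); lra.
  have d0 : 0 <= d by exact: le_trans (normr_ge0 _) (pq _ xr).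
  pose A := 2 / 2 ^+ n + d.
  have A0 : 0 <= A by rewrite addr_ge0// divr_ge0// exprn_ge0.
  have -> : 2 / 2 ^+ n.+1 + d = (A + d) / 2.
    by rewrite /A exprS; field.
  have e1 : 1 <= e.
    by rewrite /e -expR0 ler_expR mulr_ge0//; lra.
  split.
  - have pd := primitive_on_lin 1 (-1) py pz.
    have := primitive_on_exp_bound (L := L) (c := A) ltac:(lra) pd xr.
    have h s : 0 <= s <= r -> `|1 * y1 s + -1 * z1 s| <= A * expR (L * s).
      move=> sr; have -> : 1 * y1 s + -1 * z1 s = y1 s - z1 s by ring.
      exact: (IH s sr).2.
    move=> /(_ h); rewrite yz0 -/e.
    have -> : 1 * y x + -1 * z x - (1 * z 0 + -1 * z 0) = y x - z x by ring.
    move=> /le_trans; apply.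
    have : A / L * (e - 1) <= A / 2 * e.
      by rewrite ler_pM//; [rewrite divr_ge0//; lra|lra|rewrite ler_wpM2l// lef_pV2// posrE; lra|lra].
    have : 0 <= d * e by rewrite mulr_ge0//; lra.
    lra.
  - have pd := primitive_on_lin 1 (-1) py1 pz1.
    have := primitive_on_exp_bound (L := L) (c := L / 2 * A + d) ltac:(lra) pd xr.
    have h s : 0 <= s <= r -> `|1 * (p s * y s) + -1 * (q s * z s)| <= (L / 2 * A + d) * expR (L * s).
      move=> sr; have -> : 1 * (p s * y s) + -1 * (q s * z s) = p s * (y s - z s) + (p s - q s) * z s by ring.
      apply: (le_trans (ler_normD _ _)); rewrite !normrM mulrDl -mulrA lerD// ler_pM//.
      + exact: pL.
      + exact: (IH s sr).1.
      + exact: pq.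
      + exact: (bz s sr).1.
    move=> /(_ h); rewrite yz1 -/e.
    have -> : 1 * y1 x + -1 * z1 x - (1 * z1 0 + -1 * z1 0) = y1 x - z1 x by ring.
    move=> /le_trans; apply.
    have -> : (L / 2 * A + d) / L = A / 2 + d / L by field; lra.
    have h1 : d / L <= d / 2 by rewrite ler_wpM2l// lef_pV2// posrE; lra.
    have h2 : 0 <= d / L by rewrite divr_ge0//; lra.
    apply: (@le_trans _ _ ((A / 2 + d / 2) * e)); last by lra.
    by rewrite ler_pM//; lra.
move=> x xr; have [h1 h2] : (forall n, `|y x - z x| <= d * expR (L * x) + 2 * expR (L * x) / 2 ^+ n)
    /\ (forall n, `|y1 x - z1 x| <= d * expR (L * x) + 2 * expR (L * x) / 2 ^+ n).
  by split=> n; have [] := iter n x xr; lra.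
by split; [exact: le_of_dyadic h1 | exact: le_of_dyadic h2].
Qed.

Section Iterates.
Variables (r L alpha beta : R) (p : R -> R).
Hypotheses (r0 : 0 <= r) (L2 : 2 <= L) (alpha1 : `|alpha| <= 1) (beta1 : `|beta| <= 1).
Hypotheses (mp : measurable_fun `[0, r] p) (pL : forall x, 0 <= x <= r -> `|p x| <= L / 2).

Fixpoint picard n : (R -> R) * (R -> R) :=
  if n is m.+1 then
    (fun x => alpha + \int[leb]_(t in `[0, x]) (picard m).2 t,
     fun x => beta + \int[leb]_(t in `[0, x]) (p t * (picard m).1 t))
  else (cst alpha, cst beta).

Let exp_ge1 x : 0 <= x <= r -> 1 <= expR (L * x).
Proof. have hL := L2; move=> x0; rewrite -expR0 ler_expR mulr_ge0//; lra. Qed.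

Let expm x : 0 <= x <= r -> expR (L * x) <= expR (L * r).
Proof. have hL := L2; move=> x0; rewrite ler_expR ler_wpM2l//; lra. Qed.

Definition picard_ok (w : (R -> R) * (R -> R)) := 
  [/\ measurable_fun `[0, r] w.1, measurable_fun `[0, r] w.2 &
   forall x, 0 <= x <= r -> `|w.1 x| <= expR (L * x) /\ `|w.2 x| <= expR (L * x)].

Let picard_ok_step w : picard_ok w ->
  [/\ measurable_fun `[0, r] (fun x => p x * w.1 x),
     bounded_on 0 r w.2 & bounded_on 0 r (fun x => p x * w.1 x)].
Proof.
move=> [m1 m2 b12]; split.
- exact: measurable_funM.
- exists (expR (L * r)) => x xr; apply: (le_trans (b12 _ xr).2); exact: expm.
- exists (L / 2 * expR (L * r)) => x xr; rewrite normrM ler_pM//; first exact: pL.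
  apply: (le_trans (b12 _ xr).1); exact: expm.
Qed.

Lemma picard_primitive n : picard_ok (picard n) ->
  primitive_on 0 r (picard n.+1).1 (picard n).2 /\
  primitive_on 0 r (picard n.+1).2 (fun x => p x * (picard n).1 x).
Proof.
move=> ok; have [mq b2 bq] := picard_ok_step ok; have [m1 m2 _] := ok.
by split; apply: primitive_on_integral.
Qed.

Let picard0 n : (picard n).1 0 = alpha /\ (picard n).2 0 = beta.
Proof. by case: n => //= n; rewrite set_itv1 !Rintegral_set1 !addr0. Qed.

Lemma picard_okP n : picard_ok (picard n).
Proof.
have hL := L2; have ha := alpha1; have hb := beta1.
elim: n => [|n IH].
  split=> [||x xr] /=; [exact: measurable_cst..|].
  by have := exp_ge1 xr; split; lra.
have [p1 p2] := picard_primitive IH.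
have [L1 _ l1] := primitive_on_ex_lip p1; have [M1 _ l2] := primitive_on_ex_lip p2.
split; [exact: lip_on_measurable l1|exact: lip_on_measurable l2|].
move=> x xr; have [u0 v0] := picard0 n.+1.
have [m1 m2 b12] := IH.
have e1 := exp_ge1 xr; have L0 : 0 < L by lra.
have key F c : c <= L -> `|F 0| <= 1 -> `|F x - F 0| <= c / L * (expR (L * x) - 1) -> `|F x| <= expR (L * x).
  move=> cL F0 Fx; have -> : F x = F 0 + (F x - F 0) by ring.
  apply: (le_trans (ler_normD _ _)).
  have : c / L * (expR (L * x) - 1) <= 1 * (expR (L * x) - 1).
    by rewrite ler_wpM2r ?subr_ge0// ler_pdivrMr// mul1r.
  lra.
split.
- apply: (key _ 1); [lra|by rewrite u0|].
  apply: primitive_on_exp_bound p1 xr _ => // s sr; rewrite mul1r; exact: (b12 _ sr).2.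
- apply: (key _ (L / 2)); [lra|by rewrite v0|].
  apply: primitive_on_exp_bound p2 xr _ => // s sr; rewrite normrM ler_pM//; first exact: pL.
  exact: (b12 _ sr).1.
Qed.

Let picard_cauchy n x : 0 <= x <= r ->
  `|(picard n.+1).1 x - (picard n).1 x| <= 2 * expR (L * x) / 2 ^+ n /\
  `|(picard n.+1).2 x - (picard n).2 x| <= 2 * expR (L * x) / 2 ^+ n.
Proof.
have hL := L2.
elim: n x => [|n IH] x xr.
  have [_ _ b1] := picard_okP 1; have [_ _ b0] := picard_okP 0.
  have [h1 h2] := b1 _ xr; have [h3 h4] := b0 _ xr.
  by rewrite expr0 divr1; split; apply: (le_trans (ler_normB _ _)); lra.
have [p1 p2] := picard_primitive (picard_okP n).
have [q1 q2] := picard_primitive (picard_okP n.+1).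
have [u0 v0] := picard0 n.+1; have [u0' v0'] := picard0 n.+2.
have e1 := exp_ge1 xr; have L0 : 0 < L by lra.
have n2 : 0 < 2 ^+ n :> R by rewrite exprn_gt0.
pose c : R := 2 / 2 ^+ n.
have c0 : 0 <= c by rewrite /c divr_ge0// ltW.
have ce s : 2 * expR (L * s) / 2 ^+ n = c * expR (L * s) by rewrite /c; field; lra.
have -> : 2 * expR (L * x) / 2 ^+ n.+1 = c / 2 * expR (L * x).
  by rewrite /c exprS; field; lra.
split.
- have pd := primitive_on_lin 1 (-1) q1 p1.
  have := primitive_on_exp_bound (L := L) (c := c) L0 pd xr.
  have h s : 0 <= s <= r -> `|1 * (picard n.+1).2 s + -1 * (picard n).2 s| <= c * expR (L * s).
    by move=> sr; rewrite mul1r mulN1r -ce; exact: (IH s sr).2.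
  move=> /(_ h); rewrite u0 u0'.
  have -> : 1 * (picard n.+2).1 x + -1 * (picard n.+1).1 x - (1 * alpha + -1 * alpha) =
    (picard n.+2).1 x - (picard n.+1).1 x by ring.
  move=> /le_trans; apply.
  rewrite ler_pM//; [by rewrite divr_ge0//; lra|lra| |lra].
  by rewrite ler_wpM2l// lef_pV2// posrE; lra.
- have pd := primitive_on_lin 1 (-1) q2 p2.
  have := primitive_on_exp_bound (L := L) (c := L / 2 * c) L0 pd xr.
  have h s : 0 <= s <= r -> `|1 * (p s * (picard n.+1).1 s) + -1 * (p s * (picard n).1 s)|
      <= L / 2 * c * expR (L * s).
    move=> sr; rewrite mul1r mulN1r -mulrBr normrM -[leRHS]mulrA -ce ler_pM//; first exact: pL.
    exact: (IH s sr).1.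
  move=> /(_ h); rewrite v0 v0'.
  have -> : 1 * (picard n.+2).2 x + -1 * (picard n.+1).2 x - (1 * beta + -1 * beta) =
    (picard n.+2).2 x - (picard n.+1).2 x by ring.
  move=> /le_trans; apply.
  have -> : L / 2 * c / L = c / 2 by field; lra.
  by rewrite ler_pM//; lra.
Qed.

(** The Picard iterates converge geometrically in the weighted norm.  The bound
    [`|p| <= L / 2] together with [2 <= L] is what gives the ratio [1 / 2], and the
    bound on the solution is inherited from the iterates. *)
Lemma solution_on_exists : exists y y1 : R -> R,
  [/\ solution_on 0 r p y y1, y 0 = alpha, y1 0 = beta &
   forall x, 0 <= x <= r -> `|y x| <= expR (L * x) /\ `|y1 x| <= expR (L * x)].
Proof.
have hL := L2; have hr := r0.
have /choice[y yP] : forall x, exists l, 0 <= x <= r ->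
    forall n, `|(picard n).1 x - l| <= 2 * (2 * expR (L * x)) / 2 ^+ n.
  move=> x; have [xr|_] := boolP (0 <= x <= r); last by exists 0.
  have [l lP] := geometric_limit (fun n => (picard_cauchy n xr).1).
  by exists l.
have /choice[y1 y1P] : forall x, exists l, 0 <= x <= r ->
    forall n, `|(picard n).2 x - l| <= 2 * (2 * expR (L * x)) / 2 ^+ n.
  move=> x; have [xr|_] := boolP (0 <= x <= r); last by exists 0.
  have [l lP] := geometric_limit (fun n => (picard_cauchy n xr).2).
  by exists l.
pose E := expR (L * r); have E0 : 0 <= E by rewrite expR_ge0.
have yE n x : 0 <= x <= r -> `|(picard n).1 x - y x| <= 4 * E / 2 ^+ n.
  move=> xr; apply: (le_trans (yP x xr n)).
  by rewrite ler_wpM2r ?invr_ge0 ?exprn_ge0//; have := expm xr; rewrite -/E; lra.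
have y1E n x : 0 <= x <= r -> `|(picard n).2 x - y1 x| <= 4 * E / 2 ^+ n.
  move=> xr; apply: (le_trans (y1P x xr n)).
  by rewrite ler_wpM2r ?invr_ge0 ?exprn_ge0//; have := expm xr; rewrite -/E; lra.
(* a uniform Lipschitz bound passes to the limits, which are thus measurable *)
have lim_lip (u : nat -> R -> R) l K : (forall n x, 0 <= x <= r -> `|u n x - l x| <= 4 * E / 2 ^+ n) ->
    (forall n, lip_on 0 r K (u n.+1)) -> lip_on 0 r K l.
  move=> ul Ku x z x0 xz zr; apply: (@le_of_dyadic _ _ _ (4 * E)) => n.
  have := Ku n x z x0 xz zr; have := ul n.+1 x ltac:(lra); have := ul n.+1 z ltac:(lra).
  have -> : 4 * E / 2 ^+ n.+1 = 4 * E / 2 ^+ n / 2 by rewrite exprS; field.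
  rewrite !ler_norml; lra.
have ly : lip_on 0 r E y.
  apply: (lim_lip (fun n => (picard n).1)) => // n.
  have [p1 _] := picard_primitive (picard_okP n); apply: primitive_on_lip p1 _ => x xr.
  have [_ _ b] := picard_okP n; apply: (le_trans (b _ xr).2); exact: expm.
have ly1 : lip_on 0 r (L / 2 * E) y1.
  apply: (lim_lip (fun n => (picard n).2)) => // n.
  have [_ p2] := picard_primitive (picard_okP n); apply: primitive_on_lip p2 _ => x xr.
  rewrite normrM ler_pM//; first exact: pL.
  have [_ _ b] := picard_okP n; apply: (le_trans (b _ xr).1); exact: expm.
have my := lip_on_measurable r0 ly; have my1 := lip_on_measurable r0 ly1.
have lim_eq (u : nat -> R) l c : (forall n, u n = c) -> (forall n, `|u n - l| <= 4 * E / 2 ^+ n) -> l = c.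
  move=> uc ul; apply/esym/eqP; rewrite -subr_eq0 -normr_le0.
  by apply: (@le_of_dyadic _ _ _ (4 * E)) => n; rewrite add0r -(uc n).
have zr : (0 : R) <= 0 <= r by lra.
have half n : 4 * E / 2 ^+ n.+1 <= 4 * E / 2 ^+ n.
  by rewrite ler_wpM2l ?lef_pV2 ?posrE ?exprn_gt0 ?ler_eXn2l//; [lra|rewrite ltr1n].
have LE : 4 * E <= 4 * E * L by rewrite ler_peMr//; lra.
exists y, y1; split.
- split.
  + apply: (primitive_on_limit r0 (F_ := fun n => (picard n.+1).1)
      (f_ := fun n => (picard n).2) (K := 4 * E)) => //.
    * by move=> n; have [] := picard_primitive (picard_okP n).
    * by move=> n x xr; apply: (le_trans (yE n.+1 x xr)).
  + apply: (primitive_on_limit r0 (F_ := fun n => (picard n.+1).2)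
      (f_ := fun n x => p x * (picard n).1 x) (K := 4 * E * L)) => //.
    * by move=> n; have [] := picard_primitive (picard_okP n).
    * move=> n x xr; apply: (le_trans (y1E n.+1 x xr)); apply: (le_trans (half n)).
      by rewrite ler_wpM2r// invr_ge0 exprn_ge0.
    * move=> n x xr; rewrite -mulrBr normrM.
      have -> : 4 * E * L / 2 ^+ n = L * (4 * E / 2 ^+ n) by ring.
      rewrite ler_pM//; last exact: yE.
      by apply: (le_trans (pL xr)); lra.
    * exact: measurable_funM.
- by apply: (lim_eq (fun n => (picard n).1 0)) => n; [have [] := picard0 n|exact: yE].
- by apply: (lim_eq (fun n => (picard n).2 0)) => n; [have [] := picard0 n|exact: y1E].
- move=> x xr; split; apply: (@le_of_dyadic _ _ _ (4 * E)) => n.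
  + have [_ _ /(_ _ xr)[b _]] := picard_okP n; have := yE n x xr; move: b.
    by rewrite !ler_norml; lra.
  + have [_ _ /(_ _ xr)[_ b]] := picard_okP n; have := y1E n x xr; move: b.
    by rewrite !ler_norml; lra.
Qed.

End Iterates.
End Picard.

(** * Wronskians *)

Section Wronskian.
Context {R : realType}.
Implicit Types (a b c r t : R) (p q y z : R -> R).

Lemma solution_on_sub a b x x' p y y1 : solution_on a b p y y1 ->
  a <= x -> x' <= b -> solution_on x x' p y y1.
Proof. by move=> [h1 h2] ax xb; split; [exact: primitive_on_sub h1 _ _ | exact: primitive_on_sub h2 _ _]. Qed.

Lemma solution_on_lip a b p y y1 : solution_on a b p y y1 ->
  (exists K, lip_on a b K y) /\ (exists K, lip_on a b K y1).
Proof.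
by move=> [/primitive_on_ex_lip[K _ ?] /primitive_on_ex_lip[L _ ?]];
  split; [exists K|exists L].
Qed.

Lemma primitive_on_wronskian a b p q y y1 z z1 : a <= b ->
  solution_on a b p y y1 -> solution_on a b q z z1 ->
  primitive_on a b (fun x => y1 x * z x - y x * z1 x)
                   (fun x => (p x - q x) * (y x * z x)).
Proof.
move=> ab [py py1] [pz pz1].
apply: eq_primitive_on (primitive_on_lin 1 (-1) (primitive_on_mul ab py1 pz)
  (primitive_on_mul ab py pz1)) => x _; ring.
Qed.

(** The identity [(y' z')' = p (y z)'] that carries the comparison: the right-hand
    side involves [p] but not its derivative. *)
Lemma primitive_on_deriv_mul a b p y y1 z z1 : a <= b ->
  solution_on a b p y y1 -> solution_on a b p z z1 ->
  primitive_on a b (fun x => y1 x * z1 x)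
                   (fun x => p x * (y1 x * z x + y x * z1 x)).
Proof.
move=> ab [py py1] [pz pz1].
apply: eq_primitive_on (primitive_on_mul ab py1 pz1) => x _; ring.
Qed.

Lemma wronskian_const a b p y y1 z z1 x0 x : a <= x0 <= b -> a <= x <= b ->
  solution_on a b p y y1 -> solution_on a b p z z1 ->
  y x * z1 x - y1 x * z x = y x0 * z1 x0 - y1 x0 * z x0.
Proof.
move=> x0ab xab sy sz.
have at_a u : a <= u <= b -> y1 u * z u - y u * z1 u = y1 a * z a - y a * z1 a.
  move=> /andP[au ub].
  have pw := primitive_on_wronskian au (solution_on_sub sy (lexx _) ub) (solution_on_sub sz (lexx _) ub).
  apply: (primitive_on_const au (F := fun u => y1 u * z u - y u * z1 u)).
  by apply: eq_primitive_on pw => // s _; ring.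
have := at_a _ x0ab; have := at_a _ xab; lra.
Qed.

(** The fundamental system at [0]; for a negative constant [p] these are a cosine
    and a multiple of a sine. *)
Definition cosine_sine r p y y1 z z1 : Prop :=
  [/\ solution_on 0 r p y y1, solution_on 0 r p z z1,
      y 0 = 1 /\ y1 0 = 0 & z 0 = 0 /\ z1 0 = 1].

Lemma cosine_sine_wronskian r p y y1 z z1 x : cosine_sine r p y y1 z z1 ->
  0 <= x <= r -> y x * z1 x - y1 x * z x = 1.
Proof.
move=> [sy sz [y0 y10] [z0 z10]] xr.
rewrite (@wronskian_const 0 r p y y1 z z1 0 x) //; last by lra.
by rewrite y0 y10 z0 z10; lra.
Qed.

End Wronskian.

Section HalfInterval.
Context {R : realType}.
Implicit Types (a b c r t : R) (p q y z : R -> R).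

Lemma sine_gt0 r p y y1 z z1 : cosine_sine r p y y1 z z1 ->
  forall c, c <= r -> (forall x, 0 <= x <= c -> 0 <= z1 x) ->
  forall x, 0 < x <= c -> 0 < z x.
Proof.
move=> [_ sz _ [z0 z10]] c cr z1_ge0 x /andP[x0 xc]; rewrite -z0.
have [pz _] := solution_on_sub sz (lexx _) (le_trans xc cr).
have [_ lz1] := solution_on_lip (solution_on_sub sz (lexx _) (le_trans xc cr)).
apply: (primitive_on_lt x0 pz lz1 (x0 := 0)).
- by move=> s ?; apply: z1_ge0; lra.
- lra.
- by rewrite z10.
Qed.

Lemma potential_neg_of_decrease r p z z1 a b : 0 <= a -> a <= b -> b <= r ->
  solution_on 0 r p z z1 -> (forall x, a <= x <= b -> 0 <= z x) ->
  z1 b < z1 a -> exists2 x, a < x < b & p x < 0.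
Proof.
move=> a0 ab br sz z_ge0; apply: contraPP => /forall2NP pge0.
apply/negP; rewrite -leNgt -subr_ge0.
have [_ pz1] := solution_on_sub sz a0 br.
have := primitive_on_le ab (primitive_on_affine a b 0 0) pz1.
have h x : a < x < b -> cst 0 x <= p x * z x.
  move=> xab; rewrite /= mulr_ge0//; last by apply: z_ge0; lra.
  by have [//|/negP] := pge0 x; rewrite -leNgt.
by move=> /(_ h); lra.
Qed.

(** At an interior zero a nonnegative solution has zero derivative as well, which
    the Wronskian forbids. *)
Lemma cosine_double_zero r p y y1 z z1 x : cosine_sine r p y y1 z z1 ->
  0 < x < r ->
  (forall s, 0 <= s <= r -> 0 <= y s) -> y x = 0 -> False.
Proof.
move=> CS xr y_ge0 yx.
have [sy _ _ _] := CS.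
have W := cosine_sine_wronskian CS (_ : 0 <= x <= r).
have sy1 := solution_on_sub sy (lexx 0) (ltac:(lra) : x <= r).
have le0 : y1 x <= 0.
  apply: (deriv_le0_at_zero (a := 0) _ sy1.1 (solution_on_lip sy1).2 _ yx); first lra.
  by move=> s ?; apply: y_ge0; lra.
(* for the right derivative, the same argument applies to the reflected function *)
have sy2 := solution_on_sub sy (ltac:(lra) : 0 <= x) (lexx r).
have pr := primitive_on_reflect sy2.1.
have ge0 : - y1 (- - x) <= 0.
  apply: (deriv_le0_at_zero (a := - r) (c := - x) _ pr) => /=.
  - lra.
  - have [K lK] := (solution_on_lip sy2).2; exists K => u v ur uv vx.
    have := lK (- v) (- u) ltac:(lra) ltac:(lra) ltac:(lra).
    have -> : - y1 (- v) - - y1 (- u) = y1 (- u) - y1 (- v) by ring.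
    have -> // : - u - - v = v - u by ring.
  - by move=> s ?; apply: y_ge0; lra.
  - by rewrite opprK.
have y1x : y1 x = 0 by move: ge0; rewrite opprK; lra.
by have := W ltac:(lra); rewrite yx y1x !mul0r subrr; lra.
Qed.

End HalfInterval.

(** * Comparison on the half interval *)

Section CoreComparison.
Context {R : realType}.
Implicit Types (a b c r t k m : R) (p q y z : R -> R).

Lemma const_or_lt c (p : R -> R) : 0 < c ->
  (forall x x', 0 < x -> x <= x' -> x' < c -> p x <= p x') ->
  (exists x1 x2, [/\ 0 < x1, x1 < x2, x2 < c & p x1 < p x2]) \/
  (forall x, 0 < x < c -> p x = p (c / 2)).
Proof.
move=> c0 pmon.
have [h|h] := pselect (exists x1 x2, [/\ 0 < x1, x1 < x2, x2 < c & p x1 < p x2]).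
  by left.
right=> x xc; apply/eqP/negPn/negP => pne.
have /orP[xx|xx] := le_total x (c / 2).
- have pl : p x < p (c / 2) by rewrite lt_neqAle pne pmon//; lra.
  have xlt : x < c / 2.
    by rewrite lt_neqAle xx andbT; apply/eqP => e; rewrite -e eqxx in pne.
  by apply: h; exists x, (c / 2); split => //; lra.
- have pl : p (c / 2) < p x by rewrite lt_neqAle eq_sym pne pmon//; lra.
  have xlt : c / 2 < x.
    by rewrite lt_neqAle xx andbT; apply/eqP => e; rewrite e eqxx in pne.
  by apply: h; exists (c / 2), x; split => //; lra.
Qed.

Lemma lip_on_gt0_min a b (K : R) (f : R -> R) : a <= b -> lip_on a b K f ->
  (forall x, a <= x <= b -> 0 < f x) ->
  exists2 m, 0 < m & forall x, a <= x <= b -> m <= f x.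
Proof.
move=> ab lf f0; have [x xab xmin] := lip_on_min ab lf.
by exists (f x) => //; exact: f0.
Qed.

(** For [z1] to come down from [1] to [0], the potential must be negative before
    [x0]; it is then negative afterwards by monotonicity, and [z1] would go on
    decreasing strictly, below [0]. *)
Lemma sine_deriv_zero_end r p y y1 z z1 x0 :
  cosine_sine r p y y1 z z1 ->
  (forall x x', 0 < x -> x <= x' -> x' < r -> p x' <= p x) ->
  (forall x, 0 <= x <= r -> 0 <= z1 x) ->
  0 <= x0 <= r -> z1 x0 = 0 -> x0 = r.
Proof.
move=> CS pmon z1_ge0 /andP[x00]; rewrite le_eqVlt => /orP[/eqP //|x0r] z1x0.
have [_ sz _ [z0 z10]] := CS.
have x0_gt0 : 0 < x0.
  rewrite lt_neqAle x00 andbT; apply/eqP => e.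
  by move: z10; rewrite e z1x0 => /eqP; rewrite eq_sym oner_eq0.
have z_gt0 := sine_gt0 CS (lexx _) z1_ge0.
have zx0 : 0 < z x0 by apply: z_gt0; rewrite x0_gt0 ltW.
have [u /andP[u0 ux] pu] : exists2 x, 0 < x < x0 & p x < 0.
  apply: (potential_neg_of_decrease (lexx 0) x00 (ltW x0r) sz); last by rewrite z10 z1x0.
  move=> x /andP[]; rewrite le_eqVlt => /orP[/eqP <-|xx] xr; first by rewrite z0.
  by apply/ltW/z_gt0; rewrite xx (le_trans xr (ltW x0r)).
have [pz pz1] := solution_on_sub sz x00 (lexx r).
have h s : x0 < s < r -> p s * z s <= cst (p u * z x0) s.
  move=> /andP[xs sr] /=.
  have zs : z x0 <= z s.
    apply: (primitive_on_nondecreasing (ltW xs) (primitive_on_sub pz (lexx _) (ltW sr))).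
    move=> v /andP[xv vs]; apply: z1_ge0.
    by rewrite (ltW (lt_trans x0_gt0 xv)) (ltW (lt_trans vs sr)).
  have ps : p s <= p u by apply: pmon => //; exact: ltW (lt_trans ux xs).
  apply: (@le_trans _ _ (p u * z s)).
    by rewrite ler_wpM2r// (le_trans (ltW zx0) zs).
  by rewrite ler_nM2l.
have := primitive_on_le (ltW x0r) pz1 (primitive_on_affine x0 r 0 (p u * z x0)) h.
have z1r : 0 <= z1 r by apply: z1_ge0; rewrite (le_trans x00 (ltW x0r)) lexx.
have : p u * z x0 * (r - x0) < 0 by rewrite !nmulr_rlt0 ?nmulr_rlt0// subr_gt0.
by move: z1r; rewrite z1x0; clear; lra.
Qed.

(** Suppose [z1 >= 0].  Then [z > 0], so [y] vanishes at [r]; let [c] be its first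
    zero.  On [[0, c]] the function [y z] is nonnegative and vanishes at both ends,
    and [- p] is nondecreasing, so the identity for [y1 z1] gives
    [0 <= y1 c * z1 c], with strict inequality if [p] is not constant on [(0, c)].
    But [y1 c < 0].  If [p] is constant there, what is left is [z1 c = 0], hence
    [c = r] by [sine_deriv_zero_end], and [p] is constant on [(0, r)]. *)
Lemma sine_deriv_lt0 r p y y1 z z1 : 0 < r ->
  cosine_sine r p y y1 z z1 ->
  bounded_on 0 r p ->
  (forall x x', 0 < x -> x <= x' -> x' < r -> p x' <= p x) ->
  ~ (exists k, forall x, 0 < x < r -> p x = k) ->
  y r = 0 \/ z r = 0 ->
  exists2 x, 0 <= x <= r & z1 x < 0.
Proof.
move=> r0 CS [K Kp] pmon pnc yz0; apply: contrapT => /forall2NP nlt.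
have z1_ge0 x : 0 <= x <= r -> 0 <= z1 x.
  by move=> xr; have [//|/negP] := nlt x; rewrite -leNgt.
have [sy sz [y0 y10] [z0 z10]] := CS.
have z_gt0 := sine_gt0 CS (lexx _) z1_ge0.
have yr : y r = 0 by case: yz0 => // zr; have := z_gt0 r ltac:(lra); lra.
have [[L ly] _] := solution_on_lip sy.
have [c [c0 cr yc y_gt0]] : exists c, [/\ 0 < c, c <= r, y c = 0 & forall x, 0 <= x < c -> 0 < y x].
  by apply: (first_zero (ltW r0) ly); lra.
have syc := solution_on_sub sy (lexx _) cr; have szc := solution_on_sub sz (lexx _) cr.
have zc := z_gt0 c ltac:(lra).
have y_ge0 x : 0 <= x <= c -> 0 <= y x.
  move=> /andP[x0]; rewrite le_eqVlt => /orP[/eqP ->|xc]; first by rewrite yc.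
  by apply/ltW/y_gt0; lra.
have z_ge0 x : 0 <= x <= c -> 0 <= z x.
  move=> /andP[]; rewrite le_eqVlt => /orP[/eqP <-|x0] xc; first by rewrite z0.
  by apply/ltW/z_gt0; lra.
have y1c : y1 c < 0.
  have := cosine_sine_wronskian CS (ltac:(lra) : 0 <= c <= r).
  rewrite yc mul0r add0r => W.
  by rewrite ltNge; apply/negP => /mulr_ge0 /(_ (ltW zc)); lra.
have z1c := z1_ge0 c ltac:(lra).
have pf := primitive_on_mul (ltW c0) syc.1 szc.1.
pose P x := - p x.
have pH : primitive_on 0 c (fun x => - (y1 x * z1 x))
    (fun x => P x * (y1 x * z x + y x * z1 x)).
  have pH := primitive_on_deriv_mul (ltW c0) syc szc.
  by apply: eq_primitive_on (primitive_on_lin (-1) 0 pH pH) => x _; rewrite /P; ring.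
have Pmon x x' : 0 < x -> x <= x' -> x' < c -> P x <= P x'.
  by move=> ? ? ?; rewrite /P lerN2 pmon//; lra.
have f_ge0 x : 0 <= x <= c -> 0 <= y x * z x.
  by move=> xc; rewrite mulr_ge0 ?y_ge0 ?z_ge0.
have [[x1 [x2 [x10 x12 x2c Px]]]|Pcst] := const_or_lt c0 Pmon.
- have [L2 _ lf] := primitive_on_ex_lip (primitive_on_sub pf (ltW x10) (ltW x2c)).
  have [m m0 fm] : exists2 m, 0 < m & forall x, x1 <= x <= x2 -> m <= y x * z x.
    apply: (lip_on_gt0_min (ltW x12) lf) => x xx.
    by rewrite mulr_gt0//; [apply: y_gt0|apply: z_gt0]; lra.
  have gap : - (y1 c * z1 c) - - (y1 0 * z1 0) <=
      K * (y c * z c) - (- K) * (y 0 * z 0) - m * (P x2 - P x1).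
    apply: (monotone_by_parts_gap pf pH Pmon _ f_ge0 x10 x12 x2c fm) => x xc.
    by have := Kp x ltac:(lra); rewrite /P ler_norml; lra.
  have : 0 < m * (P x2 - P x1) by rewrite mulr_gt0// subr_gt0.
  have : y1 c * z1 c <= 0 by rewrite mulr_le0_ge0// ltW.
  by move: gap; rewrite yc y10 z0; lra.
- set k := P (c / 2) in Pcst.
  have Hc : - (y1 c * z1 c) - - (y1 0 * z1 0) <=
      k * (y c * z c - 0) - k * (y 0 * z 0 - 0).
    apply: (monotone_by_parts c0 pf pH Pmon _ f_ge0) => x xc.
    by rewrite Pcst// lexx.
  have z1c0 : z1 c = 0.
    apply/eqP; rewrite eq_le z1c andbT leNgt; apply/negP => z1c_gt0.
    have : 0 < - y1 c * z1 c by rewrite mulr_gt0// oppr_gt0.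
    by move: Hc; rewrite yc y10 z0; lra.
  have cr' : c = r by apply: (sine_deriv_zero_end CS pmon z1_ge0 _ z1c0); rewrite ltW.
  by apply: pnc; exists (- k) => x; rewrite -cr' => /Pcst <-; rewrite /P opprK.
Qed.

(** Suppose [y >= 0], hence [y x > 0] for [0 <= x < r], and let [c] be the first
    zero of [z1].  As [p] is nondecreasing and [z1] comes down to [0], [p] is negative on
    [(0, c)], so the boundary term of [monotone_by_parts_gap] at [c] can be taken
    to be [0].  The identity for [y1 z1], which vanishes at [0] and at [c], then
    forces [p] to be a negative constant on [(0, c)] and [y c = 0]; hence [c = r],
    and [p] is constant on [(0, r)]. *)
Lemma cosine_lt0 r p y y1 z z1 : 0 < r ->
  cosine_sine r p y y1 z z1 ->
  bounded_on 0 r p ->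
  (forall x x', 0 < x -> x <= x' -> x' < r -> p x <= p x') ->
  ~ (exists k, forall x, 0 < x < r -> p x = k) ->
  z1 r = 0 ->
  exists2 x, 0 <= x <= r & y x < 0.
Proof.
move=> r0 CS [K Kp] pmon pnc z1r; apply: contrapT => /forall2NP nlt.
have y_ge0 x : 0 <= x <= r -> 0 <= y x.
  by move=> xr; have [//|/negP] := nlt x; rewrite -leNgt.
have [sy sz [y0 y10] [z0 z10]] := CS.
have y_gt0 x : 0 <= x < r -> 0 < y x.
  move=> /andP[]; rewrite le_eqVlt => /orP[/eqP <-|x0] xr; first by rewrite y0.
  rewrite lt_neqAle y_ge0 ?andbT; last by lra.
  by apply/eqP => /esym; apply: (cosine_double_zero CS) => //; lra.
have [_ [L lz1]] := solution_on_lip sz.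
have [c [c0 cr z1c z1_gt0]] : exists c, [/\ 0 < c, c <= r, z1 c = 0 & forall x, 0 <= x < c -> 0 < z1 x].
  by apply: (first_zero (ltW r0) lz1); lra.
have syc := solution_on_sub sy (lexx _) cr; have szc := solution_on_sub sz (lexx _) cr.
have z1_ge0 x : 0 <= x <= c -> 0 <= z1 x.
  move=> /andP[x0]; rewrite le_eqVlt => /orP[/eqP ->|xc]; first by rewrite z1c.
  by apply/ltW/z1_gt0; lra.
have z_gt0 := sine_gt0 CS cr z1_ge0.
have z_ge0 x : 0 <= x <= c -> 0 <= z x.
  move=> /andP[]; rewrite le_eqVlt => /orP[/eqP <-|x0] xc; first by rewrite z0.
  by apply/ltW/z_gt0; lra.
have p_lt0 x : 0 < x < c -> p x < 0.
  move=> xc; have zx := z1_gt0 x ltac:(lra).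
  have [u uc pu] : exists2 u, x < u < c & p u < 0.
    apply: (potential_neg_of_decrease _ _ cr sz); [lra|lra| |lra].
    by move=> s sc; apply: z_ge0; lra.
  by apply: (le_lt_trans _ pu); apply: pmon; lra.
have pf := primitive_on_mul (ltW c0) syc.1 szc.1.
have pH := primitive_on_deriv_mul (ltW c0) syc szc.
have pmonc x x' : 0 < x -> x <= x' -> x' < c -> p x <= p x'.
  by move=> ? ? ?; rewrite pmon//; lra.
have f_ge0 x : 0 <= x <= c -> 0 <= y x * z x.
  by move=> xc; rewrite mulr_ge0 ?y_ge0 ?z_ge0//; lra.
have [[x1 [x2 [x10 x12 x2c px]]]|pcst] := const_or_lt c0 pmonc.
- have [L2 _ lf] := primitive_on_ex_lip (primitive_on_sub pf (ltW x10) (ltW x2c)).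
  have [m m0 fm] : exists2 m, 0 < m & forall x, x1 <= x <= x2 -> m <= y x * z x.
    apply: (lip_on_gt0_min (ltW x12) lf) => x xx.
    by rewrite mulr_gt0//; [apply: y_gt0|apply: z_gt0]; lra.
  have gap : y1 c * z1 c - y1 0 * z1 0 <=
      0 * (y c * z c) - (- K) * (y 0 * z 0) - m * (p x2 - p x1).
    apply: (monotone_by_parts_gap pf pH pmonc _ f_ge0 x10 x12 x2c fm) => x xc.
    by have := Kp x ltac:(lra); have := p_lt0 x xc; rewrite ler_norml; lra.
  have : 0 < m * (p x2 - p x1) by rewrite mulr_gt0// subr_gt0.
  by move: gap; rewrite z1c y10 z0; lra.
- set k := p (c / 2) in pcst.
  have k0 : k < 0 by apply: p_lt0; lra.
  have Hc : y1 c * z1 c - y1 0 * z1 0 <=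
      k * (y c * z c - 0) - k * (y 0 * z 0 - 0).
    apply: (monotone_by_parts c0 pf pH pmonc _ f_ge0) => x xc.
    by rewrite pcst// lexx.
  move: cr; rewrite le_eqVlt => /orP[/eqP cr|cr].
    by apply: pnc; exists k => x xr; apply: pcst; rewrite cr.
  have : 0 < - k * (y c * z c).
    by rewrite !mulr_gt0 ?oppr_gt0//; [apply: y_gt0|apply: z_gt0]; lra.
  by move: Hc; rewrite z1c y10 z0; lra.
Qed.

End CoreComparison.

(** * Positive solutions and lowest eigenvalues *)

Section LowParameter.
Context {R : realType}.
Implicit Types (a b c r t k m d : R) (p q y z : R -> R).

(** A first zero is impossible, since up to it [y] is convex and starts
    horizontally. *)
Lemma cosine_growth r p y y1 z z1 : cosine_sine r p y y1 z z1 ->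
  (forall x, 0 < x < r -> 0 <= p x) ->
  forall x, 0 <= x <= r -> 1 <= y x.
Proof.
move=> [[py py1] _ [y0 y10] _] p0.
have grow c : 0 <= c <= r -> (forall x, 0 <= x <= c -> 0 <= y x) -> 1 <= y c.
  move=> /andP[c0 cr] y_ge0; rewrite -y0.
  apply: primitive_on_nondecreasing (primitive_on_sub py (lexx _) cr) _ => // x xc.
  rewrite -y10.
  have xr : x <= r by lra.
  apply: (primitive_on_nondecreasing _ (primitive_on_sub py1 (lexx _) xr)); first lra.
  by move=> s sx; rewrite mulr_ge0//; [apply: p0|apply: y_ge0]; lra.
have [L L0 ly] := primitive_on_ex_lip py.
have y_gt0 x : 0 <= x <= r -> 0 < y x.
  move=> /andP[x0 xr]; rewrite ltNge; apply/negP => yx.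
  have lyx : lip_on 0 x L y by move=> u v ? ? ?; apply: ly => //; lra.
  have [c [c0 cx yc pos]] := first_zero x0 lyx (ltac:(lra) : 0 < y 0) yx.
  have h s : 0 <= s <= c -> 0 <= y s.
    move=> /andP[s0]; rewrite le_eqVlt => /orP[/eqP ->|sc]; first by rewrite yc.
    by apply/ltW/pos; lra.
  by have := grow c ltac:(lra) h; rewrite yc; lra.
by move=> x xr; apply: grow => // s sx; apply/ltW/y_gt0; lra.
Qed.

Lemma cosine_deriv_gt0 r p y y1 z z1 : 0 < r -> cosine_sine r p y y1 z z1 ->
  (forall x, 0 < x < r -> 1 <= p x) -> 0 < y1 r.
Proof.
move=> r0 CS p1.
have y_ge1 := cosine_growth CS (fun x xr => le_trans ler01 (p1 x xr)).
case: CS => [[py py1] _ [y0 y10] _].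
have := primitive_on_le (ltW r0) (primitive_on_affine 0 r 0 1) py1.
have h x : 0 < x < r -> cst 1 x <= p x * y x.
  by move=> xr; rewrite /= -[leLHS]mulr1 ler_pM// ?p1 ?y_ge1//; lra.
by move=> /(_ h); lra.
Qed.

Lemma sine_deriv_growth r p y y1 z z1 : cosine_sine r p y y1 z z1 ->
  (forall x, 0 < x < r -> 0 <= p x) ->
  forall x, 0 <= x <= r -> 0 < z1 x.
Proof.
move=> [_ [pz pz1] _ [z0 z10]] p0 x /andP[x0 xr]; rewrite ltNge; apply/negP => z1x.
have [L L0 lz1] := primitive_on_ex_lip pz1.
have lzx : lip_on 0 x L z1 by move=> u v ? ? ?; apply: lz1 => //; lra.
have [c [c0 cx z1c pos]] := first_zero x0 lzx (ltac:(lra) : 0 < z1 0) z1x.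
have cr : c <= r by lra.
have := primitive_on_nondecreasing (ltW c0) (primitive_on_sub pz1 (lexx _) cr).
have h s : 0 < s < c -> 0 <= p s * z s.
  move=> sc; rewrite mulr_ge0//; first by apply: p0; lra.
  have sr : s <= r by lra.
  rewrite -z0; apply: primitive_on_nondecreasing (primitive_on_sub pz (lexx _) sr) _; first lra.
  by move=> u us; apply/ltW/pos; lra.
by move=> /(_ h); rewrite z1c; lra.
Qed.

(** Sturm comparison.  If [u a > 0], let [c] be the first zero of [u], or [b] if
    there is none.  The Wronskian [y u1 - y1 u] vanishes at [a] and strictly
    increases on [[a, c]], yet at [c] it is nonpositive. *)
Lemma neumann_positive_lowest a b p q d y y1 u u1 : a < b -> 0 < d ->
  solution_on a b p y y1 -> solution_on a b q u u1 ->
  (forall x, a <= x <= b -> p x = q x - d) ->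
  (forall x, a <= x <= b -> 0 < y x) -> y1 a = 0 -> y1 b = 0 ->
  u1 a = 0 -> u1 b = 0 -> u a = 0.
Proof.
move=> ab d0 sy + pq y_gt0 y1a y1b.
have main (v v1 : R -> R) : solution_on a b q v v1 -> v1 a = 0 -> v1 b = 0 -> v a <= 0.
  move=> sv v1a v1b; rewrite leNgt; apply/negP => va.
  have [[L lv] _] := solution_on_lip sv.
  have [c [ac cb v_ge0 vc]] : exists c, [/\ a < c, c <= b,
      forall x, a <= x <= c -> 0 <= v x & v c = 0 \/ c = b].
    have [[x xab vx]|/forall2NP vpos] := pselect (exists2 x, a <= x <= b & v x <= 0).
      have [ax xb] := andP xab.
      have lvx : lip_on a x L v by move=> s s' ? ? ?; apply: lv => //; lra.
      have [c [ac cx vc pos]] := first_zero ax lvx va vx.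
      exists c; split => //; [lra| |by left].
      move=> s /andP[as_]; rewrite le_eqVlt => /orP[/eqP ->|sc]; first by rewrite vc.
      by apply/ltW/pos; lra.
    exists b; split => //; last by right.
    by move=> s sb; have [//|/negP] := vpos s; rewrite -ltNge => /ltW.
  have svc := solution_on_sub sv (lexx _) cb; have syc := solution_on_sub sy (lexx _) cb.
  have pw := primitive_on_wronskian (ltW ac) syc svc.
  have pf := primitive_on_mul (ltW ac) syc.1 svc.1.
  have pnw : primitive_on a c (fun x => y x * v1 x - y1 x * v x) (fun x => d * (y x * v x)).
    apply: eq_primitive_on (primitive_on_lin (-1) 0 pw pw) => x xac; first by ring.
    by rewrite pq; [ring|lra].
  have := primitive_on_lt ac pnw (x0 := a).
  have [K K0 lf] := primitive_on_ex_lip pf.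
  have h1 : exists K, lip_on a c K (fun x => d * (y x * v x)).
    exists (d * K) => s s' sa ss sc; rewrite -mulrBr normrM (ger0_norm (ltW d0)) -mulrA.
    by apply: ler_wpM2l; [exact: ltW | exact: lf].
  have h2 x : a <= x <= c -> 0 <= d * (y x * v x).
    by move=> xc; rewrite !mulr_ge0 ?(ltW d0) ?v_ge0// ltW// y_gt0//; lra.
  move=> /(_ h1 h2); rewrite lexx (ltW ac) v1a y1a !mul0r mulr0 subrr => /(_ isT).
  have ya : 0 < y a by apply: y_gt0; lra.
  rewrite !mulr_gt0// => /(_ isT).
  case: vc => [vc|->]; last by rewrite v1b y1b mul0r mulr0 subrr ltxx.
  have v1c : v1 c <= 0.
    by apply: (deriv_le0_at_zero ac svc.1 (solution_on_lip svc).2 v_ge0 vc).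
  have yc : 0 < y c by apply: y_gt0; lra.
  have : y c * v1 c <= 0 by rewrite mulr_ge0_le0// ltW.
  by rewrite vc mulr0; lra.
move=> su u1a u1b; apply/eqP; rewrite eq_le (main _ _ su)//=.
have sN : solution_on a b q (fun x => - u x) (fun x => - u1 x).
  have [pu pu1] := su; split.
    by apply: eq_primitive_on (primitive_on_lin (-1) 0 pu pu) => x _; ring.
  by apply: eq_primitive_on (primitive_on_lin (-1) 0 pu1 pu1) => x _; ring.
by have := main _ _ sN; rewrite u1a u1b oppr0 => /(_ erefl erefl); lra.
Qed.

End LowParameter.

(** * Even and odd solutions *)

Section Symmetric.
Context {R : realType}.
Implicit Types (a b c r t k m d : R) (p q y z : R -> R).

Definition parity_ext (sigma : R) y x := if x < 0 then sigma * y (- x) else y x.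

Lemma parity_ext_ge0 sigma y x : 0 <= x -> parity_ext sigma y x = y x.
Proof. by rewrite /parity_ext ltNge => ->. Qed.

Lemma solution_on_parity_ext r p y y1 sigma : 0 <= r ->
  (forall x, 0 <= x <= r -> p (- x) = p x) ->
  solution_on 0 r p y y1 -> sigma * y 0 = y 0 -> - sigma * y1 0 = y1 0 ->
  solution_on (- r) r p (parity_ext sigma y) (parity_ext (- sigma) y1).
Proof.
move=> r0 peven [py py1] sy0 sy10.
have rN : - r <= 0 by lra.
have qy := primitive_on_reflect py; have qy1 := primitive_on_reflect py1.
rewrite oppr0 in qy qy1.
have ext_le0 s (w : R -> R) x : s * w 0 = w 0 -> x <= 0 -> parity_ext s w x = s * w (- x).
  move=> sw; rewrite le_eqVlt /parity_ext => /orP[/eqP ->|->//].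
  by rewrite ltxx oppr0 sw.
split; apply: (primitive_on_glue rN r0).
- apply: eq_primitive_on (primitive_on_lin sigma 0 qy qy) => x xr.
    by rewrite ext_le0//; [ring|lra].
  by rewrite ext_le0//; [ring|lra].
- by apply: eq_primitive_on py => x xr; rewrite parity_ext_ge0//; lra.
- apply: eq_primitive_on (primitive_on_lin (- sigma) 0 qy1 qy1) => x xr.
    by rewrite ext_le0//; [ring|lra].
  rewrite ext_le0//; last by lra.
  have -> : p x = p (- x) by rewrite -[in LHS](opprK x) peven//; lra.
  by ring.
- by apply: eq_primitive_on py1 => x xr; rewrite parity_ext_ge0//; lra.
Qed.

Section Extension.
Variables (r : R) (p y y1 z z1 : R -> R).

Definition symmetric_setting :=
  [/\ 0 < r, forall x, 0 <= x <= r -> p (- x) = p x & cosine_sine r p y y1 z z1].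

Lemma even_solution : symmetric_setting ->
  solution_on (- r) r p (parity_ext 1 y) (parity_ext (- 1) y1).
Proof.
move=> [r0 pe [sy _ [y0 y10] _]]; apply: solution_on_parity_ext => //.
- exact: ltW.
- by rewrite mul1r.
- by rewrite y10 mulr0.
Qed.

Lemma odd_solution : symmetric_setting ->
  solution_on (- r) r p (parity_ext (- 1) z) (parity_ext 1 z1).
Proof.
move=> [r0 pe [_ sz _ [z0 z10]]].
rewrite -[X in parity_ext X z1]opprK; apply: solution_on_parity_ext => //.
- exact: ltW.
- by rewrite z0 mulr0.
- by rewrite opprK mul1r.
Qed.

(** The coefficients [u 0] and [u1 0] are the constant Wronskians of [u] with the
    odd and the even solution, and Cramer's rule with determinant [1] recovers [u]
    from them. *)
Lemma symmetric_decomposition u u1 : symmetric_setting ->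
  solution_on (- r) r p u u1 -> forall x, - r <= x <= r ->
  u x = u 0 * parity_ext 1 y x + u1 0 * parity_ext (- 1) z x /\
  u1 x = u 0 * parity_ext (- 1) y1 x + u1 0 * parity_ext 1 z1 x.
Proof.
move=> S su x xr; have se := even_solution S; have so := odd_solution S.
have [r0 pe [_ _ [y0 y10] [z0 z10]]] := S.
have zero : - r <= 0 <= r by lra.
have := wronskian_const zero xr se so; have := wronskian_const zero xr se su.
have := wronskian_const zero xr su so.
rewrite !(parity_ext_ge0 _ _ (lexx 0)) y0 y10 z0 z10.
set Y := parity_ext 1 y x; set Y1 := parity_ext (- 1) y1 x.
set Z := parity_ext (- 1) z x; set Z1 := parity_ext 1 z1 x.
rewrite !mulr0 !mul0r !mul1r !mulr1 !subr0 => W1 W2 W3.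
by split; [rewrite -[LHS]mulr1|rewrite -[LHS]mulr1]; rewrite -W3 -W1 -W2; ring.
Qed.

Lemma parity_ext_end sigma (w : R -> R) : 0 < r ->
  parity_ext sigma w (- r) = sigma * w r /\ parity_ext sigma w r = w r.
Proof.
move=> r0; split; last by rewrite parity_ext_ge0// ltW.
by rewrite /parity_ext oppr_lt0 r0 opprK.
Qed.

Lemma symmetric_dirichlet u u1 x0 : symmetric_setting ->
  solution_on (- r) r p u u1 -> u (- r) = 0 -> u r = 0 ->
  - r <= x0 <= r -> u x0 != 0 -> y r = 0 \/ z r = 0.
Proof.
move=> S su ul ur x0r ux0; have [r0 _ _] := S.
have [el _] := symmetric_decomposition S su (ltac:(lra) : - r <= - r <= r).
have [er _] := symmetric_decomposition S su (ltac:(lra) : - r <= r <= r).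
have [e0 _] := symmetric_decomposition S su x0r.
move: el er; rewrite ul ur.
have [-> ->] := parity_ext_end 1 y r0; have [-> ->] := parity_ext_end (-1) z r0.
move=> el er.
have /eqP : u 0 * y r = 0 by lra.
have /eqP : u1 0 * z r = 0 by lra.
rewrite !mulf_eq0 => /orP[/eqP u10|/eqP ->]; last by right.
move=> /orP[/eqP u0|/eqP ->]; last by left.
by move: ux0; rewrite e0 u0 u10 !mul0r addr0 eqxx.
Qed.

Lemma symmetric_neumann u u1 : symmetric_setting ->
  solution_on (- r) r p u u1 -> u1 (- r) = 0 -> u1 r = 0 ->
  u 0 * y1 r = 0 /\ u1 0 * z1 r = 0.
Proof.
move=> S su ul ur; have [r0 _ _] := S.
have [_ el] := symmetric_decomposition S su (ltac:(lra) : - r <= - r <= r).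
have [_ er] := symmetric_decomposition S su (ltac:(lra) : - r <= r <= r).
move: el er; rewrite ul ur.
have [-> ->] := parity_ext_end (-1) y1 r0; have [-> ->] := parity_ext_end 1 z1 r0.
by move=> el er; split; lra.
Qed.

End Extension.
End Symmetric.

(** * Eigenfunctions as solutions *)

Section Operators.
Context {R : realType}.
Local Notation leb := (@lebesgue_measure R).
Implicit Types (a b c r t k m d : R) (V u f F : R -> R).

(** The potential is set to [0] at and beyond the end points: the values of [V] at
    [- r] and [r] are arbitrary and could break the symmetry. *)
Definition potential a b V x := if a < x < b then V x else 0.

Lemma potential_measurable a b V : measurable_fun `]a, b[ V ->
  measurable_fun `[a, b] (potential a b V).
Proof.
move=> mV; apply: (@measurable_fun_itv_cc _ _ _ false true).
apply: eq_measurable_fun mV => x; rewrite inE /= in_itv /= => xab.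
by rewrite /potential xab.
Qed.

Lemma ac_with_deriv_primitive a b F f : a <= b -> ac_with_deriv a b F f ->
  forall x y, a <= x -> x <= y -> y <= b -> F y - F x = \int[leb]_(t in `[x, y]) f t.
Proof.
move=> ab [intf Ff] x y ax xy yb.
have int z : z <= b -> leb.-integrable `[a, z] (EFin \o f).
  by move=> zb; apply: integrableS intf => //; exact: subset_segment.
have Fx : F x = F a + \int[leb]_(t in `[a, x]) f t by apply: Ff; rewrite in_itv /=; lra.
have Fy : F y = F a + \int[leb]_(t in `[a, y]) f t by apply: Ff; rewrite in_itv /=; lra.
rewrite Fx Fy opprD addrACA subrr add0r Rintegral_itvB ?bnd_simp//; last exact: int.
apply: Rintegral_itv_obnd_cbnd.
apply: integrableS (int y yb) => //.
by apply: subset_itv; rewrite bnd_simp.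
Qed.

Lemma ac_with_deriv_continuous a b F f : a <= b -> ac_with_deriv a b F f ->
  {within `[a, b], continuous F}.
Proof.
move=> ab [intf Ff]; have cI := parameterized_integral_continuous ab intf.
apply: (@subspace_eq_continuous _ _ _ (fun x => F a + \int[leb]_(t in `[a, x]) f t)).
  by move=> x; rewrite inE => /Ff.
by move=> x; apply: cvgD; [exact: cvg_cst | exact: cI].
Qed.

Lemma continuous_bounded_on a b F : a <= b -> {within `[a, b], continuous F} ->
  bounded_on a b F.
Proof.
move=> ab cF; have [c _ cmax] := EVT_max ab cF; have [d _ dmin] := EVT_min ab cF.
exists (`|F c| + `|F d|) => x xab.
have := cmax x; rewrite in_itv => /(_ xab); have := dmin x; rewrite in_itv => /(_ xab).
have := ler_norm (- F d); rewrite normrN; have := ler_norm (F c); have := normr_ge0 (F c); have := normr_ge0 (F d).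
by rewrite ler_norml; lra.
Qed.

(** The equation gives the second derivative of an eigenfunction almost everywhere;
    replacing it by the bounded function [(V - t) u] does not change its
    integrals. *)
Lemma weak_solution_on a b V t u u1 u2 : a < b ->
  measurable_fun `]a, b[ V -> (exists M, {in `]a, b[, forall x, `|V x| <= M}) ->
  H2_with_derivs a b u u1 u2 ->
  ae_eq leb `]a, b[%classic (fun x => t * u x) (fun x => - u2 x + V x * u x) ->
  solution_on a b (fun x => potential a b V x - t) u u1.
Proof.
move=> ab mV [M VM] [acu acu1 _] eqn; have leab := ltW ab.
have cu1 := ac_with_deriv_continuous leab acu1.
have pu : primitive_on a b u u1.
  split; last exact: ac_with_deriv_primitive.
    by apply: subspace_continuous_measurable_fun.
  exact: continuous_bounded_on.
have [L L0 lu] := primitive_on_ex_lip pu.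
have mu := lip_on_measurable leab lu.
have [K K0 Ku] := bounded_on_ge0 (lip_on_bounded lu).
split=> //; set w := fun x => _.
have mw : measurable_fun `[a, b] w.
  apply: measurable_funM => //; apply: measurable_funB => //.
  exact: potential_measurable.
have bw : bounded_on a b w.
  exists ((`|M| + `|t|) * K) => x xab; rewrite normrM ler_pM//; last exact: Ku.
  apply: (le_trans (ler_normB _ _)); rewrite lerD2r /potential.
  case: ifP => xo; last by rewrite normr0.
  by apply: (le_trans _ (ler_norm M)); apply: VM; rewrite in_itv.
split=> // x y ax xy yb.
rewrite (ac_with_deriv_primitive leab acu1)//.
have intu2 : leb.-integrable `[x, y] (EFin \o u2).
  by case: acu1 => i _; apply: integrableS i => //; exact: subset_segment.
have intw : leb.-integrable `[x, y] (EFin \o w).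
  by apply: integrableS (bounded_integrable_itv mw bw) => //; exact: subset_segment.
rewrite !Rintegral_segment_open// /Rintegral; congr fine.
have oc : `]x, y[ `<=` `[x, y] by exact: subset_itv_oo_cc.
apply: ae_eq_integral => //.
- by apply: (measurable_int leb); exact: integrableS intu2.
- by apply: (measurable_int leb); exact: integrableS intw.
- apply: filterS eqn => s /= eqs; rewrite in_itv /= => sxy.
  have sab : a < s < b by lra.
  have := eqs; rewrite in_itv /= => /(_ sab) e.
  by congr EFin; rewrite /w /potential sab; lra.
Qed.

Lemma solution_on_H2 a b V t u u1 : a < b ->
  measurable_fun `]a, b[ V -> (exists M, {in `]a, b[, forall x, `|V x| <= M}) ->
  solution_on a b (fun x => potential a b V x - t) u u1 ->
  let u2 x := (potential a b V x - t) * u x in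
  H2_with_derivs a b u u1 u2 /\
  ae_eq leb `]a, b[%classic (fun x => t * u x) (fun x => - u2 x + V x * u x).
Proof.
move=> ab mV bV [pu pu1] u2; have leab := ltW ab.
have ac F f : primitive_on a b F f -> ac_with_deriv a b F f.
  move=> pF; split; first exact: primitive_on_integrable pF.
  move=> x; rewrite in_itv /= => /andP[ax xb].
  by case: pF => _ _ <-//; lra.
have [mu2 [K Ku2] _] := pu1.
have mo : measurable_fun `]a, b[ u2.
  by apply: measurable_funS mu2 => //; exact: subset_itv_oo_cc.
split; last first.
  apply: aeW => x /=; rewrite in_itv /= => xab.
  by rewrite /u2 /potential xab; ring.
split; [exact: ac|exact: ac|split => //].
have int2 : leb.-integrable `[a, b] (EFin \o (fun x => u2 x ^+ 2)).
  apply: bounded_integrable_itv; first exact: measurable_funX.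
  by exists (K * K) => x xab; rewrite expr2 normrM ler_pM// Ku2.
by apply: integrableS int2 => //; exact: subset_itv_oo_cc.
Qed.

End Operators.

(** * Lists of eigenvalues *)

Section EigenvalueLists.
Context {R : realType}.
Local Notation leb := (@lebesgue_measure R).
Implicit Types (a b t : R) (u v : R -> R) (A : (R -> R) -> (R -> R) -> Prop).

Definition ae_zero a b u := ae_eq leb `]a, b[%classic u (fun=> 0).

Lemma listed_eigenfunction a b A m k : eigenvalue_seq a b A m -> (0 < k)%N ->
  exists2 u, A u (fun x => m k * u x) & ~ ae_zero a b u.
Proof.
move=> [_ /(_ (m k))[n [[e [eE efree _]] card]]] k0.
case: n => [|n] in e eE efree card *.
  have : [set j | (0 < j)%N /\ m j = m k] k by [].
  by move: card; rewrite II0 card_eq0 => /eqP ->.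
exists (e ord0); first exact: eE.
move=> e0; have := efree (fun i => (i == ord0)%:R) _ ord0.
rewrite eqxx; apply/not_implyP; split; last by apply/eqP; rewrite oner_eq0.
apply: filterS e0 => x /= e0x xab.
rewrite (bigD1 ord0)//= big1 ?addr0 ?mul1r; first exact: e0x.
by move=> i /negPf ->; rewrite mul0r.
Qed.

Lemma eigenvalue_listed a b A m t u : eigenvalue_seq a b A m ->
  A u (fun x => t * u x) -> ~ ae_zero a b u -> exists2 k, (0 < k)%N & m k = t.
Proof.
move=> [_ /(_ t)[n [[e [_ _ espan]] card]]] Au u0.
case: n => [|n] in e espan card *.
  case: u0; have [c] := espan u Au; apply: filterS => x /= ux xab.
  by rewrite ux// big_ord0.
have [[k [k0 mk]]|nex] := pselect (exists k, (0 < k)%N /\ m k = t).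
  by exists k.
have E0 : [set k | (0 < k)%N /\ m k = t] = set0.
  by rewrite -subset0 => k kP; apply: nex; exists k.
by move: card; rewrite E0 card_eq_sym card_eq0 => /eqP e0; have : `I_n.+1 0%N by []; rewrite e0.
Qed.

(** A value that is listed twice has multiplicity at least two. *)
Lemma repeated_eigenvalue a b A m k : eigenvalue_seq a b A m -> (0 < k)%N ->
  m k = m k.+1 ->
  exists u v, [/\ A u (fun x => m k * u x), A v (fun x => m k * v x) &
    forall c d, ae_zero a b (fun x => c * u x + d * v x) -> c = 0 /\ d = 0].
Proof.
move=> [_ /(_ (m k))[n [[e [eE efree _]] card]]] k0 mk.
have n2 : (1 < n)%N.
  rewrite ltnNge; apply/negP => n1.
  have /pcard_eqP[f] := card.
  have inj := @inj _ _ [set j | (0 < j)%N /\ m j = m k] f.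
  have f0 j : (0 < j)%N -> m j = m k -> f j = 0%N.
    move=> j0 mj; have : `I_n (f j) by apply: funS.
    by rewrite /=; case: n n1 {f inj e eE efree card} (f j) => [|[]]// _ [].
  have : k = k.+1.
    by apply: inj; rewrite ?inE//= !f0.
  by move/eqP; rewrite -[X in X == _]addn0 -addn1 eqn_add2l.
case: n n2 => [|[|n]]// _ in e eE efree card *.
exists (e ord0), (e (lift ord0 ord0)); split; [exact: eE|exact: eE|].
move=> c d cd0.
pose w (i : 'I_n.+2) : R := if i == ord0 then c else if i == lift ord0 ord0 then d else 0.
have w0 : forall i, w i = 0.
  apply: efree; apply: filterS cd0 => x /= cdx xab.
  rewrite (bigD1 ord0)//= (bigD1 (lift ord0 ord0))//= big1.
    by rewrite /w eqxx /= addr0; exact: cdx.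
  by move=> i /andP[/negPf i0 /negPf i1]; rewrite /w i0 i1 mul0r.
by split; [exact: (w0 ord0)|exact: (w0 (lift ord0 ord0))].
Qed.

End EigenvalueLists.

(** * Shooting in the spectral parameter *)

Section Shooting.
Context {R : realType}.
Implicit Types (a b c r t k m d E M T : R) (p q Q : R -> R).

Definition fundamental_family r Q T (y y1 z z1 : R -> R -> R) E :=
  (forall t, - T <= t <= T ->
     cosine_sine r (fun x => Q x - t) (y t) (y1 t) (z t) (z1 t)) /\
  (forall x, 0 <= x <= r ->
     [/\ lip_on (- T) T E (y^~ x), lip_on (- T) T E (y1^~ x) &
         lip_on (- T) T E (z1^~ x)]).

Lemma fundamental_family_exists r Q T M : 0 <= r -> 0 <= T -> 0 <= M ->
  measurable_fun `[0, r] Q -> (forall x, 0 <= x <= r -> `|Q x| <= M) ->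
  exists y y1 z z1 E, fundamental_family r Q T y y1 z z1 E.
Proof.
move=> r0 T0 M0 mQ QM; pose L := 2 * (M + T) + 2.
have L2 : 2 <= L by rewrite /L; lra.
have mp t : measurable_fun `[0, r] (fun x => Q x - t).
  by apply: measurable_funB => //; exact: measurable_cst.
have pL t : - T <= t <= T -> forall x, 0 <= x <= r -> `|Q x - t| <= L / 2.
  move=> tT x /QM; rewrite !ler_norml /L; lra.
have fam alpha beta : `|alpha| <= 1 -> `|beta| <= 1 -> exists w w1 : R -> R -> R,
    (forall t, - T <= t <= T -> [/\ solution_on 0 r (fun x => Q x - t) (w t) (w1 t),
       w t 0 = alpha & w1 t 0 = beta]) /\
    (forall x, 0 <= x <= r -> lip_on (- T) T (expR (L * r)) (w^~ x) /\
       lip_on (- T) T (expR (L * r)) (w1^~ x)).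
  move=> a1 b1.
  have /choice[W WP] : forall t, exists W : (R -> R) * (R -> R), - T <= t <= T ->
      [/\ solution_on 0 r (fun x => Q x - t) W.1 W.2, W.1 0 = alpha, W.2 0 = beta &
        forall x, 0 <= x <= r -> `|W.1 x| <= expR (L * x) /\ `|W.2 x| <= expR (L * x)].
    move=> t; have [tT|_] := boolP (- T <= t <= T); last by exists (cst 0, cst 0).
    have [w [w1 H]] := solution_on_exists r0 L2 a1 b1 (mp t) (pL t tT).
    by exists (w, w1).
  exists (fun t => (W t).1), (fun t => (W t).2); split.
    by move=> t /WP[].
  move=> x xr.
  have dep s t : - T <= s -> s <= t -> t <= T ->
      `|(W t).1 x - (W s).1 x| <= expR (L * r) * (t - s) /\
      `|(W t).2 x - (W s).2 x| <= expR (L * r) * (t - s).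
    move=> sT st tT.
    have tTT : - T <= t <= T by lra.
    have [s1 i1 j1 b1'] := WP t tTT.
    have [s2 i2 j2 b2'] := WP s ltac:(lra).
    have := @solution_on_lip_dependence _ r L _ _ _ _ _ _ (t - s) L2 s1 s2 _ _ (pL t tTT) _ b1' b2' x xr.
    rewrite i1 i2 j1 j2 => /(_ erefl erefl).
    have h u : 0 <= u <= r -> `|Q u - t - (Q u - s)| <= t - s.
      by move=> _; rewrite ler_norml; lra.
    move=> /(_ h) [h1 h2].
    have e : (t - s) * expR (L * x) <= expR (L * r) * (t - s).
      rewrite mulrC ler_wpM2r ?subr_ge0// ler_expR ler_wpM2l//; lra.
    by split; [exact: le_trans h1 e|exact: le_trans h2 e].
  by split=> s t sT st tT; have [] := dep s t sT st tT.
have n0 : `|0 : R| <= 1 by rewrite normr0.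
have n1 : `|1 : R| <= 1 by rewrite normr1.
have [y [y1 [yP yL]]] := fam _ _ n1 n0; have [z [z1 [zP zL]]] := fam _ _ n0 n1.
exists y, y1, z, z1, (expR (L * r)); split.
  by move=> t tT; have [? ? ?] := yP t tT; have [? ? ?] := zP t tT.
by move=> x xr; have [? ?] := yL x xr; have [? ?] := zL x xr.
Qed.

Lemma lip_on_param_sub T s0 s1 E (f : R -> R) : lip_on (- T) T E f -> - T <= s0 -> s1 <= T ->
  lip_on s0 s1 E f.
Proof. by move=> lf h0 h1 u v ? ? ?; apply: lf => //; lra. Qed.

(** The value [- T] of the parameter lies below the infimum of [Q] minus [1], where
    [z1] is positive on [[0, r]] and [y1] at [r]; [s] is the critical parameter for [z1], and [t] comes
    from the sign change of [y1] at [r] between [- T] and [s]. *)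
Lemma two_neumann_parameters r Q T M (y y1 z z1 : R -> R -> R) E l : 0 < r ->
  (forall x, 0 <= x <= r -> `|Q x| <= M) ->
  (forall x x', 0 < x -> x <= x' -> x' < r -> Q x' <= Q x) ->
  ~ (exists k, forall x, 0 < x < r -> Q x = k) ->
  fundamental_family r Q T y y1 z z1 E -> M + 1 <= T -> - T <= l <= T ->
  y l r = 0 \/ z l r = 0 ->
  exists t s, [/\ - T <= t, t < s, s < l, y1 t r = 0 & z1 s r = 0].
Proof.
move=> r0 QM Qmon Qnc [CS lips] MT lT yz.
have T_ge0 x : 0 < x < r -> 1 <= Q x - - T.
  by move=> xr; have := QM x ltac:(lra); rewrite ler_norml; lra.
have pmon t x x' : 0 < x -> x <= x' -> x' < r -> Q x' - t <= Q x - t.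
  by move=> *; rewrite lerD2r; exact: Qmon.
have z1neg : exists2 x, 0 <= x <= r & z1 l x < 0.
  apply: (sine_deriv_lt0 r0 (CS l lT) _ (pmon l) _ yz).
  - exists (M + `|l|) => x xr; apply: (le_trans (ler_normB _ _)).
    by rewrite lerD2r QM.
  - by move=> [k Qk]; apply: Qnc; exists (k + l) => x xr; rewrite -(Qk x)//; ring.
have TT : - T <= - T <= T by lra.
have z1pos x : 0 <= x <= r -> 0 < z1 (- T) x.
  by apply: (sine_deriv_growth (CS _ TT)) => s sr; have := T_ge0 s sr; lra.
have [s [sT z1s [x0 x0r z1x0]]] : exists s, [/\ - T < s < l,
    forall x, 0 <= x <= r -> 0 <= z1 s x & exists2 x, 0 <= x <= r & z1 s x = 0].
  apply: (@critical_parameter _ 0 r (- T) l z1 E) => //; [lra|lra| |].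
  - move=> s sl; have sT : - T <= s <= T by lra.
    by have [_ /solution_on_lip[]] := CS s sT.
  - by move=> x /lips[_ _ lz]; apply: (lip_on_param_sub lz); lra.
have sTT : - T <= s <= T by lra.
have z1sr : z1 s r = 0 by rewrite -(sine_deriv_zero_end (CS s sTT) (pmon s) z1s x0r z1x0).
have zsr : 0 < z s r by apply: (sine_gt0 (CS s sTT) (lexx _) z1s); lra.
have W := cosine_sine_wronskian (CS s sTT) (ltac:(lra) : 0 <= r <= r).
rewrite z1sr mulr0 in W.
have y1s : y1 s r < 0.
  by rewrite ltNge; apply/negP => h; have := mulr_ge0 h (ltW zsr); lra.
have y1T : 0 < y1 (- T) r by exact: (cosine_deriv_gt0 r0 (CS _ TT) T_ge0).
have [_ ly1 _] := lips r (ltac:(lra) : 0 <= r <= r).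
have sT' : - T <= s by lra.
have [t [Tt ts y1t _]] := first_zero sT' (lip_on_param_sub ly1 (lexx _) (ltac:(lra) : s <= T)) y1T (ltW y1s).
exists t, s; split => //; [lra| |lra].
by rewrite lt_neqAle ts andbT; apply/eqP => e; move: y1s; rewrite -e y1t ltxx.
Qed.

(** At the critical parameter [y] is nonnegative with a zero, and an interior zero
    would be double. *)
Lemma dirichlet_parameter_below r Q T M (y y1 z z1 : R -> R -> R) E l : 0 < r ->
  (forall x, 0 <= x <= r -> `|Q x| <= M) ->
  fundamental_family r Q T y y1 z z1 E -> M + 1 <= T -> - T <= l <= T ->
  (exists2 x, 0 <= x <= r & y l x < 0) ->
  exists s, [/\ - T <= s, s < l & y s r = 0].
Proof.
move=> r0 QM [CS lips] MT lT yneg.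
have T_ge0 x : 0 < x < r -> 0 <= Q x - - T.
  by move=> xr; have := QM x ltac:(lra); rewrite ler_norml; lra.
have TT : - T <= - T <= T by lra.
have ypos x : 0 <= x <= r -> 0 < y (- T) x.
  by move=> xr; apply: lt_le_trans (cosine_growth (CS _ TT) T_ge0 xr).
have [s [sT ys [x0 x0r yx0]]] : exists s, [/\ - T < s < l,
    forall x, 0 <= x <= r -> 0 <= y s x & exists2 x, 0 <= x <= r & y s x = 0].
  apply: (@critical_parameter _ 0 r (- T) l y E) => //; [lra|lra| |].
  - move=> s sl; have sT : - T <= s <= T by lra.
    by have [/solution_on_lip[]] := CS s sT.
  - by move=> x /lips[ly _ _]; apply: (lip_on_param_sub ly); lra.
have sTT : - T <= s <= T by lra.
exists s; split; [lra|lra|].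
have [_ _ [y0 _] _] := CS s sTT.
have [x0lt|] := ltP x0 r; last by move=> ?; have -> : r = x0 by lra.
have x0gt : 0 < x0.
  by rewrite lt_neqAle (andP x0r).1 andbT; apply/eqP => e; move: yx0; rewrite -e y0; lra.
by case: (cosine_double_zero (CS s sTT) (ltac:(lra) : 0 < x0 < r) ys yx0).
Qed.

End Shooting.

(** * The two eigenvalue inequalities *)

Section Assembly.
Context {R : realType}.
Local Notation leb := (@lebesgue_measure R).
Implicit Types (r t : R) (V u v : R -> R).

Lemma potential_symmetric r V : {in `]- r, r[, forall x, V (- x) = V x} ->
  forall x, potential (- r) r V (- x) = potential (- r) r V x.
Proof.
move=> Vs x; rewrite /potential.
have -> : (- r < - x < r) = (- r < x < r) by rewrite ltrN2 ltrNl andbC.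
by case: ifP => // xr; apply: Vs; rewrite in_itv.
Qed.

Lemma potential_bounded r V M : {in `]- r, r[, forall x, `|V x| <= M} ->
  0 <= M -> forall x, `|potential (- r) r V x| <= M.
Proof.
move=> VM M0 x; rewrite /potential; case: ifP => xr; last by rewrite normr0.
by apply: VM; rewrite in_itv.
Qed.

Lemma not_ae_zero_ex a b u : ~ ae_zero a b u -> exists2 x, a < x < b & u x != 0.
Proof.
move=> u0; apply: contrapT => /forall2NP h; apply: u0; apply: aeW => x /=.
rewrite in_itv /= => xab; apply/eqP/negPn/negP => ux.
by case: (h x) => //; rewrite xab.
Qed.

Lemma solution_not_ae_zero a b p u u1 x : a < b -> solution_on a b p u u1 ->
  a <= x <= b -> u x != 0 -> ~ ae_zero a b u.
Proof.
move=> ab su xab ux u0; have [[K lu] _] := solution_on_lip su.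
by move: ux; rewrite (lip_on_ae_eq0 ab lu u0 xab) eqxx.
Qed.

Lemma eigenvalue_seq_le a b A (m : nat -> R) j k : eigenvalue_seq a b A m ->
  (0 < j)%N -> (j <= k)%N -> m j <= m k.
Proof. by move=> [nd _]; case: j => // j _; case: k => // k jk; exact: nd. Qed.

Lemma second_eigenvalue_le a b A (m : nat -> R) j k s : eigenvalue_seq a b A m ->
  (0 < j)%N -> (0 < k)%N -> m j != m k -> m j <= s -> m k <= s -> m 2%N <= s.
Proof.
move=> ms j0 k0 ne js ks.
have [k2|k1] := leqP 2 k.
  exact: le_trans (eigenvalue_seq_le ms _ k2) ks.
have [j2|j1] := leqP 2 j.
  exact: le_trans (eigenvalue_seq_le ms _ j2) js.
have one i : (0 < i)%N -> (i < 2)%N -> i = 1%N.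
  by move=> i0 i1; apply/eqP; rewrite eqn_leq i0 andbT.
by move: ne; rewrite (one _ j0 j1) (one _ k0 k1) eqxx.
Qed.

Section Symmetric.
Variables (r M : R) (V : R -> R).
Hypotheses (r_gt0 : 0 < r) (M_ge0 : 0 <= M)
  (VM : {in `]- r, r[, forall x, `|V x| <= M})
  (mV : measurable_fun `]- r, r[ V)
  (Vs : {in `]- r, r[, forall x, V (- x) = V x}).

Let Q := potential (- r) r V.
Let ab : - r < r. Proof. have := r_gt0; lra. Qed.
Let bV : exists M, {in `]- r, r[, forall x, `|V x| <= M}. Proof. by exists M. Qed.

Lemma listed_dirichlet lam k : dirichlet_eigenvalues (- r) r V lam -> (0 < k)%N ->
  exists u u1, [/\ solution_on (- r) r (fun x => Q x - lam k) u u1,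
    u (- r) = 0, u r = 0 & exists2 x, - r < x < r & u x != 0].
Proof.
move=> hl k0; have [u [u1 [u2 [H2 ul ur eqn]]] u0] := listed_eigenfunction hl k0.
exists u, u1; split => //; last exact: not_ae_zero_ex u0.
exact: (weak_solution_on ab mV bV H2 eqn).
Qed.

Lemma listed_neumann mu k : neumann_eigenvalues (- r) r V mu -> (0 < k)%N ->
  exists u u1, [/\ solution_on (- r) r (fun x => Q x - mu k) u u1,
    u1 (- r) = 0, u1 r = 0 & exists2 x, - r < x < r & u x != 0].
Proof.
move=> hl k0; have [u [u1 [u2 [H2 ul ur eqn]]] u0] := listed_eigenfunction hl k0.
exists u, u1; split => //; last exact: not_ae_zero_ex u0.
exact: (weak_solution_on ab mV bV H2 eqn).
Qed.

Lemma dirichlet_listed lam t u u1 x : dirichlet_eigenvalues (- r) r V lam ->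
  solution_on (- r) r (fun x => Q x - t) u u1 -> u (- r) = 0 -> u r = 0 ->
  - r <= x <= r -> u x != 0 -> exists2 k, (0 < k)%N & lam k = t.
Proof.
move=> hl su ul ur xr ux.
apply: (eigenvalue_listed hl _ (solution_not_ae_zero ab su xr ux)).
have [H2 eqn] := solution_on_H2 ab mV bV su.
by exists u1; eexists; split; [exact: H2| | |exact: eqn].
Qed.

Lemma neumann_listed mu t u u1 x : neumann_eigenvalues (- r) r V mu ->
  solution_on (- r) r (fun x => Q x - t) u u1 -> u1 (- r) = 0 -> u1 r = 0 ->
  - r <= x <= r -> u x != 0 -> exists2 k, (0 < k)%N & mu k = t.
Proof.
move=> hl su ul ur xr ux.
apply: (eigenvalue_listed hl _ (solution_not_ae_zero ab su xr ux)).
have [H2 eqn] := solution_on_H2 ab mV bV su.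
by exists u1; eexists; split; [exact: H2| | |exact: eqn].
Qed.

Let QM x : `|Q x| <= M. Proof. exact: potential_bounded. Qed.

Lemma symmetric_family T : 0 <= T -> exists y y1 z z1 E,
  fundamental_family r Q T y y1 z z1 E /\
  forall t, - T <= t <= T ->
    symmetric_setting r (fun x => Q x - t) (y t) (y1 t) (z t) (z1 t).
Proof.
move=> T0; have hr := r_gt0.
have mQ : measurable_fun `[0, r] Q.
  apply: measurable_funS (potential_measurable mV) => //.
  by apply: subset_segment => //; lra.
have [y [y1 [z [z1 [E fam]]]]] := fundamental_family_exists (ltW r_gt0) T0 M_ge0 mQ (fun x _ => QM x).
exists y, y1, z, z1, E; split => // t tT; split => //; last exact: (fam.1 t tT).
by move=> x _; rewrite /Q potential_symmetric.
Qed.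

Let Q_eq x : 0 < x < r -> Q x = V x.
Proof. by move=> xr; have hr := r_gt0; rewrite /Q /potential ifT//; lra. Qed.

Lemma neumann2_lt_dirichlet1 mu lam :
  neumann_eigenvalues (- r) r V mu -> dirichlet_eigenvalues (- r) r V lam ->
  {in `]0, r[ &, nonincreasing_fun V} ->
  ~ (exists c : R, {in `]0, r[, forall x, V x = c}) ->
  mu 2%N < lam 1%N.
Proof.
move=> hmu hlam Vmon Vnc; have hr := r_gt0; have hM := M_ge0.
set l := lam 1%N; pose T := `|l| + M + 2.
have lT : - T <= l <= T by rewrite /T; have := ler_norm l; have := ler_norm (- l); rewrite normrN; lra.
have T0 : 0 <= T by rewrite /T; have := normr_ge0 l; lra.
have [y [y1 [z [z1 [E [fam sym]]]]]] := symmetric_family T0.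
have Qmon x x' : 0 < x -> x <= x' -> x' < r -> Q x' <= Q x.
  by move=> x0 xx xr; rewrite !Q_eq; [apply: Vmon => //; rewrite in_itv /=; lra|lra|lra].
have Qnc : ~ (exists k, forall x, 0 < x < r -> Q x = k).
  by move=> [k Qk]; apply: Vnc; exists k => x; rewrite in_itv /= => xr; rewrite -Q_eq// Qk.
have [u [u1 [su ul ur [x0 x0r ux0]]]] := listed_dirichlet hlam (ltn0Sn 0).
have yz : y l r = 0 \/ z l r = 0.
  by apply: (symmetric_dirichlet (sym l lT) su ul ur _ ux0); lra.
have MT : M + 1 <= T by rewrite /T; have := normr_ge0 l; lra.
have [t [s [Tt ts sl y1t z1s]]] := two_neumann_parameters r_gt0 (fun x _ => QM x) Qmon Qnc fam MT lT yz.
have tT : - T <= t <= T by lra.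
have sT : - T <= s <= T by lra.
have [y1l y1r] := parity_ext_end (- 1) (y1 t) r_gt0.
have [z1l z1r] := parity_ext_end 1 (z1 s) r_gt0.
have [_ _ [_ _ [y0 _] _]] := sym t tT.
have [j j0 mj] : exists2 k, (0 < k)%N & mu k = t.
  apply: (neumann_listed (x := 0) hmu (even_solution (sym t tT))).
  - by rewrite y1l y1t mulr0.
  - by rewrite y1r.
  - by lra.
  - by rewrite parity_ext_ge0// y0 oner_eq0.
have W := cosine_sine_wronskian (fam.1 s sT) (ltac:(lra) : 0 <= r <= r).
have [k k0 mk] : exists2 k, (0 < k)%N & mu k = s.
  apply: (neumann_listed (x := r) hmu (odd_solution (sym s sT))).
  - by rewrite z1l z1s mulr0.
  - by rewrite z1r.
  - by lra.
  - have [_ ->] := parity_ext_end (- 1) (z s) r_gt0.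
    by apply/eqP => zs; move: W; rewrite zs z1s !mulr0 subrr; lra.
apply: le_lt_trans sl; apply: (second_eigenvalue_le hmu j0 k0).
- by rewrite mj mk lt_eqF.
- by rewrite mj ltW.
- by rewrite mk.
Qed.

Lemma solution_zero_data p y y1 z z1 u u1 : symmetric_setting r p y y1 z z1 ->
  solution_on (- r) r p u u1 -> u (- r) = 0 -> u1 (- r) = 0 ->
  forall x, - r <= x <= r -> u x = 0.
Proof.
move=> S su ul u1l x xr; have hr := r_gt0.
have [_ _ CS] := S.
have W := cosine_sine_wronskian CS (ltac:(lra) : 0 <= r <= r).
have [e e1] := symmetric_decomposition S su (ltac:(lra) : - r <= - r <= r).
have [ex _] := symmetric_decomposition S su xr.
move: e e1; rewrite ul u1l.
have [-> _] := parity_ext_end 1 y r_gt0; have [-> _] := parity_ext_end (-1) z r_gt0.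
have [-> _] := parity_ext_end (-1) y1 r_gt0; have [-> _] := parity_ext_end 1 z1 r_gt0.
move=> e e1.
have u0 : u 0 = 0.
  rewrite -[LHS]mulr1 -W.
  transitivity (z1 r * (u 0 * (1 * y r) + u1 0 * (-1 * z r)) +
    z r * (u 0 * (-1 * y1 r) + u1 0 * (1 * z1 r))); first by ring.
  by rewrite -e -e1 !mulr0 addr0.
have u10 : u1 0 = 0.
  rewrite -[LHS]mulr1 -W.
  transitivity (y1 r * (u 0 * (1 * y r) + u1 0 * (-1 * z r)) +
    y r * (u 0 * (-1 * y1 r) + u1 0 * (1 * z1 r))); first by ring.
  by rewrite -e -e1 !mulr0 addr0.
by rewrite ex u0 u10 !mul0r addr0.
Qed.

(** Since [z1] does not vanish at [r], the eigenvalue [mu 2] is simple with an even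
    eigenfunction, so [mu 1 < mu 2].  If the eigenfunction had no sign change, it
    would be positive, and [neumann_positive_lowest] would annihilate the
    eigenfunctions of [mu 1]. *)
Lemma even_neumann_sign_change mu T y y1 z z1 E :
  neumann_eigenvalues (- r) r V mu ->
  fundamental_family r Q T y y1 z z1 E ->
  (forall t, - T <= t <= T ->
    symmetric_setting r (fun x => Q x - t) (y t) (y1 t) (z t) (z1 t)) ->
  - T <= mu 1%N <= T -> - T <= mu 2%N <= T ->
  z1 (mu 2%N) r != 0 ->
  exists2 x, 0 <= x <= r & y (mu 2%N) x < 0.
Proof.
move=> hmu fam sym m1T m2T z1r; have hr := r_gt0.
apply: contrapT => /forall2NP nlt; set m := mu 2%N in z1r nlt m2T *.
have S := sym m m2T; have CS := fam.1 m m2T.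
have y_ge0 x : 0 <= x <= r -> 0 <= y m x.
  by move=> xr; have [//|/negP] := nlt x; rewrite -leNgt.
have [u [u1 [su ul ur [x0 x0r ux0]]]] := listed_neumann hmu (ltn0Sn 1).
have [ey ez] := symmetric_neumann S su ul ur.
have u10 : u1 0 = 0 by apply/eqP; move/eqP: ez; rewrite mulf_eq0 (negPf z1r) orbF.
have [ex0 _] := symmetric_decomposition S su (ltac:(lra) : - r <= x0 <= r).
have u0 : u 0 != 0.
  by apply: contraNN ux0 => /eqP u0; rewrite ex0 u0 u10 !mul0r addr0.
have y1r : y1 m r = 0 by apply/eqP; move/eqP: ey; rewrite mulf_eq0 (negPf u0).
have W := cosine_sine_wronskian CS (ltac:(lra) : 0 <= r <= r).
have [_ _ [y0 _] _] := CS.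
have y_gt0 x : 0 <= x <= r -> 0 < y m x.
  move=> xr; rewrite lt_neqAle y_ge0// andbT; apply/eqP => /esym yx.
  have [xlt|] := ltP x r; last first.
    move=> ?; have xe : x = r by lra.
    by move: W; rewrite -xe yx xe y1r !mul0r subrr; lra.
  have xgt : 0 < x.
    by rewrite lt_neqAle (andP xr).1 andbT; apply/eqP => e; move: yx; rewrite -e y0; lra.
  by apply: (cosine_double_zero CS (ltac:(lra) : 0 < x < r) y_ge0 yx).
have m12 : mu 1%N <= m by exact: (eigenvalue_seq_le hmu).
move: m12; rewrite le_eqVlt => /orP[/eqP m12|m12].
- have [v [w [Av Aw free]]] := repeated_eigenvalue hmu (ltn0Sn 0) m12.
  have multiple f : neumann_schrodinger (- r) r V f (fun x => mu 1%N * f x) ->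
      forall x, - r <= x <= r -> f x = f 0 * parity_ext 1 (y m) x.
    rewrite m12 => -[f1 [f2 [H2 fl fr eqn]]] x xr.
    have sf := weak_solution_on ab mV bV H2 eqn.
    have [_ ef] := symmetric_neumann S sf fl fr.
    have f10 : f1 0 = 0 by apply/eqP; move/eqP: ef; rewrite mulf_eq0 (negPf z1r) orbF.
    by have [-> _] := symmetric_decomposition S sf xr; rewrite f10 mul0r addr0.
  have [w0 v0] : w 0 = 0 /\ - v 0 = 0.
    apply: free; apply: aeW => x /=; rewrite in_itv /= => xr.
    have xr' : - r <= x <= r by lra.
    by rewrite (multiple v Av x xr') (multiple w Aw x xr'); ring.
  have [one _] : 1 = 0 :> R /\ 0 = 0 :> R.
    apply: free; apply: aeW => x /=; rewrite in_itv /= => xr.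
    have xr' : - r <= x <= r by lra.
    have v00 : v 0 = 0 by lra.
    by rewrite (multiple v Av x xr') v00; ring.
  by move/eqP: one; rewrite oner_eq0.
- have [v [v1 [sv vl vr [x1 x1r vx1]]]] := listed_neumann hmu (ltn0Sn 0).
  have v0 : v (- r) = 0.
    have [el er] := parity_ext_end (- 1) (y1 m) r_gt0.
    apply: (@neumann_positive_lowest _ (- r) r _ _ (m - mu 1%N) _ _ v v1 ab _ (even_solution S) sv) => //.
    + by rewrite subr_gt0.
    + by move=> x _; ring.
    + move=> x xr; rewrite /parity_ext; case: (ltP x 0) => x00; last by apply: y_gt0; lra.
      by rewrite mul1r; apply: y_gt0; lra.
    + by rewrite el y1r mulr0.
    + by rewrite er.
  have := solution_zero_data (sym _ m1T) sv v0 vl (ltac:(lra) : - r <= x1 <= r).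
  by move/eqP; rewrite (negPf vx1).
Qed.

Lemma dirichlet1_lt_neumann2 mu lam :
  neumann_eigenvalues (- r) r V mu -> dirichlet_eigenvalues (- r) r V lam ->
  {in `]0, r[ &, nondecreasing_fun V} ->
  ~ (exists c : R, {in `]0, r[, forall x, V x = c}) ->
  lam 1%N < mu 2%N.
Proof.
move=> hmu hlam Vmon Vnc; have hr := r_gt0; have hM := M_ge0.
set m := mu 2%N; pose T := `|m| + `|mu 1%N| + M + 2.
have m1 := ler_norm m; have m2 := ler_norm (- m); rewrite normrN in m2.
have m3 := ler_norm (mu 1%N); have m4 := ler_norm (- mu 1%N); rewrite normrN in m4.
have mT : - T <= m <= T by rewrite /T; lra.
have m1T : - T <= mu 1%N <= T by rewrite /T; lra.
have T0 : 0 <= T by rewrite /T; lra.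
have MT : M + 1 <= T by rewrite /T; lra.
have [y [y1 [z [z1 [E [fam sym]]]]]] := symmetric_family T0.
have neg : exists2 x, 0 <= x <= r & y m x < 0.
  have [z1r|z1r] := eqVneq (z1 m r) 0; last exact: (even_neumann_sign_change hmu fam sym).
  apply: (cosine_lt0 r_gt0 (fam.1 m mT) _ _ _ z1r).
  - exists (M + `|m|) => x xr; apply: (le_trans (ler_normB _ _)).
    by rewrite lerD2r.
  - move=> x x' x0 xx xr; rewrite lerD2r !Q_eq; [|lra|lra].
    by apply: Vmon => //; rewrite in_itv /=; lra.
  - move=> [k Qk]; apply: Vnc; exists (k + m) => x; rewrite in_itv /= => xr.
    by rewrite -Q_eq// -(Qk x)//; ring.
have [s [Ts sm ys]] := dirichlet_parameter_below r_gt0 (fun x _ => QM x) fam MT mT neg.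
have sT : - T <= s <= T by lra.
have [_ _ [_ _ [y0 _] _]] := sym s sT.
have [yl yr] := parity_ext_end 1 (y s) r_gt0.
have [k k0 lk] : exists2 k, (0 < k)%N & lam k = s.
  apply: (dirichlet_listed (x := 0) hlam (even_solution (sym s sT))).
  - by rewrite yl ys mulr0.
  - by rewrite yr.
  - by lra.
  - by rewrite parity_ext_ge0// y0 oner_eq0.
by apply: le_lt_trans sm; rewrite -lk; exact: (eigenvalue_seq_le hlam).
Qed.

End Symmetric.
End Assembly.

Theorem theorem3p3 (R : realType) (r : R) (V : R -> R) (mu lam : nat -> R)
    (r_gt0 : 0 < r)
    (V_bounded : exists M : R, {in `]- r, r[, forall x, `|V x| <= M})
    (V_measurable : measurable_fun `]- r, r[ V)
    (V_symmetric : {in `]- r, r[, forall x, V (- x) = V x})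
    (mu_neumann : neumann_eigenvalues (- r) r V mu)
    (lam_dirichlet : dirichlet_eigenvalues (- r) r V lam) :
  ({in `]0, r[ &, nonincreasing_fun V} ->
   ~ (exists c : R, {in `]0, r[, forall x, V x = c}) ->
   mu 2%N < lam 1%N) /\
  ({in `]0, r[ &, nondecreasing_fun V} ->
   ~ (exists c : R, {in `]0, r[, forall x, V x = c}) ->
   lam 1%N < mu 2%N).
Proof.
have [M VM] := V_bounded.
have M0 : 0 <= M.
  by apply: (le_trans (normr_ge0 (V 0)) (VM 0 _)); rewrite in_itv /= oppr_lt0 r_gt0.
by split; [exact: (neumann2_lt_dirichlet1 r_gt0 M0 VM) |
           exact: (dirichlet1_lt_neumann2 r_gt0 M0 VM)].
Qed.
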